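(* Let $A$ be a commutative Noetherian ring, let $\mathbf u=u_1,\dots,u_m$ ($m\ge1$) be elements of $A$, let $M,N$ be finitely generated $A$-modules, and set $I=(\mathbf u)$. Then: (1) $I\,V^*(\mathbf u,N,M)=0$, and furthermore $\operatorname{ann}M+\operatorname{ann}N\subseteq\operatorname{ann}V^*(\mathbf u,N,M)$. (2) Setting $\mathbf u'=u_1,\dots,u_{m-1}$, there is a long exact sequence, for all $i\in\mathbb Z$, $$\cdots\to V^i(\mathbf u,N,M)\to V^i(\mathbf u',N,M)\xrightarrow{\;u_m\;}V^i(\mathbf u',N,M)\to V^{i+1}(\mathbf u,N,M)\to\cdots$$
   Context: $\mathbb K^\bullet(\mathbf u,M)$ is the Koszul cochain complex $\operatorname{Hom}_A(\mathbb K_\bullet(\mathbf u),M)$ of $\mathbf u$ with coefficients in $M$; for the empty sequence, $\mathbb K^\bullet(\emptyset,M)=M$. Let $\mathbf E^\bullet$ be an injective resolution of $\mathbb K^\bullet(\mathbf u,M)$, i.e. a bounded below cochain complex of injective $A$-modules with a quasi-isomorphism $\mathbb K^\bullet(\mathbf u,M)\to\mathbf E^\bullet$. Then $V^i(\mathbf u,N,M)$ is the $i$-th cohomology module of $\operatorname{Hom}_A(N,\mathbf E^\bullet)$; it does not depend, up to isomorphism, on the choice of $\mathbf E^\bullet$. $V^*(\mathbf u,N,M)=\bigoplus_i V^i(\mathbf u,N,M)$. *)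

(* Defs.v *)
From HB Require Import structures.
From mathcomp Require Import all_boot all_order all_algebra.
From mathcomp Require Import all_classical.

Set Implicit Arguments.
Unset Strict Implicit.
Unset Printing Implicit Defensive.

Import Order.TTheory GRing.Theory Num.Theory.
Local Open Scope classical_set_scope.
Local Open Scope ring_scope.
Local Open Scope quotient_scope.

Section Ideals.
Variable A : comPzRingType.

Definition is_ideal (J : set A) : Prop :=
  [/\ J 0, (forall a b, J a -> J b -> J (a + b)) & (forall c a, J a -> J (c * a))].

Definition gen_ideal (n : nat) (u : 'I_n -> A) : set A :=
  [set a | exists c : 'I_n -> A, a = \sum_i c i * u i].

Definition noetherian : Prop :=
  forall J : set A, is_ideal J -> exists (n : nat) (u : 'I_n -> A), J = gen_ideal u.

Definition ideal_add (J K : set A) : set A :=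
  [set c | exists a b, [/\ J a, K b & c = a + b]].

Variable M : lmodType A.

Definition fin_gen : Prop :=
  exists (n : nat) (g : 'I_n -> M), forall x, exists c : 'I_n -> A, x = \sum_i c i *: g i.

Definition ann : set A := [set a | forall x : M, a *: x = 0].

Definition ideal_smul (J : set A) : set M :=
  [set y | exists (n : nat) (a : 'I_n -> A) (x : 'I_n -> M),
     (forall k, J (a k)) /\ y = \sum_k a k *: x k].

End Ideals.

Arguments ann {A} M.
Arguments fin_gen {A} M.
Arguments ideal_smul {A} M J.

Definition injective_module (A : comPzRingType) (E : lmodType A) : Prop :=
  forall (X Y : lmodType A) (f : {linear X -> Y}) (g : {linear X -> E}),
    injective f -> exists h : {linear Y -> E}, forall x, h (f x) = g x.

Definition Hom (A : comPzRingType) (X Y : lmodType A) : Type := {linear X -> Y}.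

Section HomModule.
Variables (A : comPzRingType) (X Y : lmodType A).
Implicit Types f g h : Hom X Y.

HB.instance Definition _ := gen_eqMixin (Hom X Y).
HB.instance Definition _ := gen_choiceMixin (Hom X Y).

Lemma hom_ext f g : f =1 g -> f = g.
Proof.
move: f g => [f [[f1] [f2]]] [g [[g1] [g2]]] /= /funext fg.
by move: f1 f2 g1 g2; rewrite fg => f1 f2 g1 g2; congr GRing.Linear.Pack;
  congr GRing.Linear.Class; congr (_ _); exact: Prop_irrelevance.
Qed.
End HomModule.

Section HomOps.
Variables (A : comPzRingType) (X Y : lmodType A).
Implicit Types f g h : Hom X Y.

Definition hom_scale_fun (a : A) f : X -> Y := fun x => a *: f x.

Lemma hom_scale_is_linear a f : linear (hom_scale_fun a f).
Proof.
move=> b x y; rewrite /hom_scale_fun linearP scalerDr.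
by rewrite !scalerA mulrC.
Qed.

HB.instance Definition _ a f :=
  GRing.isLinear.Build A X Y *:%R (hom_scale_fun a f) (hom_scale_is_linear a f).

Definition hom_zero : Hom X Y := GRing.Linear.clone _ _ _ _ (\0 : X -> Y) _.
Definition hom_opp f : Hom X Y := GRing.Linear.clone _ _ _ _ (\- f : X -> Y) _.
Definition hom_add f g : Hom X Y := GRing.Linear.clone _ _ _ _ (f \+ g : X -> Y) _.
Definition hom_scale (a : A) f : Hom X Y :=
  GRing.Linear.clone _ _ _ _ (hom_scale_fun a f) _.

Fact hom_addA : associative hom_add.
Proof. by move=> f g h; apply: hom_ext => x /=; rewrite addrA. Qed.
Fact hom_addC : commutative hom_add.
Proof. by move=> f g; apply: hom_ext => x /=; rewrite addrC. Qed.
Fact hom_add0 : left_id hom_zero hom_add.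
Proof. by move=> f; apply: hom_ext => x /=; rewrite add0r. Qed.
Fact hom_addN : left_inverse hom_zero hom_opp hom_add.
Proof. by move=> f; apply: hom_ext => x /=; rewrite addNr. Qed.

HB.instance Definition _ :=
  GRing.isZmodule.Build (Hom X Y) hom_addA hom_addC hom_add0 hom_addN.

Fact hom_scaleA a b f : hom_scale a (hom_scale b f) = hom_scale (a * b) f.
Proof. by apply: hom_ext => x /=; rewrite /hom_scale_fun /= /hom_scale_fun scalerA. Qed.
Fact hom_scale1 : left_id 1 hom_scale.
Proof. by move=> f; apply: hom_ext => x /=; rewrite /hom_scale_fun scale1r. Qed.
Fact hom_scaleDr : right_distributive hom_scale +%R.
Proof. by move=> a f g; apply: hom_ext => x /=; rewrite /hom_scale_fun scalerDr. Qed.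
Fact hom_scaleDl f : {morph hom_scale^~ f : a b / a + b}.
Proof. by move=> a b; apply: hom_ext => x /=; rewrite /hom_scale_fun scalerDl. Qed.

HB.instance Definition _ := GRing.Zmodule_isLmodule.Build A (Hom X Y)
  hom_scaleA hom_scale1 hom_scaleDr hom_scaleDl.

End HomOps.

Section HomFunctor.
Variables (A : comPzRingType).

Definition hom_pre (X X' Y : lmodType A) (h : {linear X' -> X}) (f : Hom X Y) :
    Hom X' Y := GRing.Linear.clone _ _ _ _ (f \o h) _.

Fact hom_pre_is_linear (X X' Y : lmodType A) (h : {linear X' -> X}) : linear (@hom_pre X X' Y h).
Proof. by move=> a f g; apply: hom_ext. Qed.

HB.instance Definition _ (X X' Y : lmodType A) (h : {linear X' -> X}) :=
  GRing.isLinear.Build A (Hom X Y) (Hom X' Y) *:%R (@hom_pre X X' Y h)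
    (@hom_pre_is_linear X X' Y h).

Definition hom_post (X Y Y' : lmodType A) (h : {linear Y -> Y'}) (f : Hom X Y) :
    Hom X Y' := GRing.Linear.clone _ _ _ _ (h \o f) _.

Fact hom_post_is_linear (X Y Y' : lmodType A) (h : {linear Y -> Y'}) : linear (@hom_post X Y Y' h).
Proof. by move=> a f g; apply: hom_ext => x /=; rewrite linearP. Qed.

HB.instance Definition _ (X Y Y' : lmodType A) (h : {linear Y -> Y'}) :=
  GRing.isLinear.Build A (Hom X Y) (Hom X Y') *:%R (@hom_post X Y Y' h)
    (@hom_post_is_linear X Y Y' h).

End HomFunctor.

(* The differential is given for every pair of degrees and vanishes unless
   they are consecutive; this avoids transports along [i - 1 + 1 = i]. *)
Record cochain (A : comPzRingType) := Cochain {
  cobj :> int -> lmodType A;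
  cdiff : forall i j : int, {linear cobj i -> cobj j};
  cdiff_shape : forall i j, i + 1 != j -> forall x, cdiff i j x = 0;
  cdiff_cdiff : forall i j k x, cdiff j k (cdiff i j x) = 0
}.

Record chain_map (A : comPzRingType) (C D : cochain A) := ChainMap {
  cmap :> forall i : int, {linear C i -> D i};
  cmap_comm : forall i j x, cdiff D i j (cmap i x) = cmap j (cdiff C i j x)
}.

Section Cohomology.
Variables (A : comPzRingType) (C : cochain A) (i : int).

Definition is_cocycle : {pred C i} := fun x => cdiff C i (i + 1) x == 0.

Fact is_cocycle_submod : submod_closed is_cocycle.
Proof.
split=> [|a x y]; rewrite !unfold_in ?linear0 ?eqxx//.
by move=> /eqP hx /eqP hy; rewrite linearP hx hy scaler0 addr0.
Qed.

HB.instance Definition _ := GRing.isSubmodClosed.Build A (C i) is_cocycle is_cocycle_submod.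

Record cocycle := Cocycle { cocycle_val : C i; _ : cocycle_val \in is_cocycle }.

HB.instance Definition _ := [isSub of cocycle for cocycle_val].
HB.instance Definition _ := [Choice of cocycle by <:].
HB.instance Definition _ := [SubChoice_isSubLmodule of cocycle by <:].

Definition is_coboundary : {pred cocycle} :=
  fun z => `[< exists y : C (i - 1), cdiff C (i - 1) i y = val z >].

Fact is_coboundary_submod : submod_closed is_coboundary.
Proof.
split=> [|a x y]; rewrite !unfold_in; first by apply/asboolP; exists 0; rewrite linear0.
move=> /asboolP[x' hx] /asboolP[y' hy]; apply/asboolP; exists (a *: x' + y').
by rewrite linearP hx hy.
Qed.

HB.instance Definition _ :=
  GRing.isSubmodClosed.Build A cocycle is_coboundary is_coboundary_submod.
HB.instance Definition _ := GRing.isOppClosed.Build cocycle is_coboundary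
  (GRing.zmod_closedN (GRing.submod_closedB is_coboundary_submod)).

Definition cohomology : Type := Quotient.quot is_coboundary.

HB.instance Definition _ := GRing.Zmodule.on cohomology.

Definition coclass (z : cocycle) : cohomology := \pi_(Quotient.quot is_coboundary) z.

Lemma coclassP (z z' : cocycle) :
  coclass z = coclass z' <-> (z - z') \in is_coboundary.
Proof. by rewrite Quotient.idealrBE; split=> /eqP. Qed.

Lemma coclassK (h : cohomology) : coclass (repr h) = h.
Proof. exact: reprK. Qed.

Lemma coclassD z z' : coclass (z + z') = coclass z + coclass z'.
Proof. by rewrite /coclass; exact: (raddfD \pi_(Quotient.quot is_coboundary)). Qed.

Definition cohom_scale (a : A) (h : cohomology) : cohomology := coclass (a *: repr h).

Lemma coclass_scale a z : cohom_scale a (coclass z) = coclass (a *: z).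
Proof.
apply/coclassP; rewrite -scalerBr.
by have /coclassP := coclassK (coclass z); exact: rpredZ.
Qed.

Fact cohom_scaleA a b h : cohom_scale a (cohom_scale b h) = cohom_scale (a * b) h.
Proof. by rewrite -[h]coclassK !coclass_scale scalerA. Qed.
Fact cohom_scale1 : left_id 1 cohom_scale.
Proof. by move=> h; rewrite -[h]coclassK !coclass_scale scale1r. Qed.
Fact cohom_scaleDr : right_distributive cohom_scale +%R.
Proof.
move=> a h k; rewrite -[h]coclassK -[k]coclassK -coclassD !coclass_scale.
by rewrite -coclassD scalerDr.
Qed.
Fact cohom_scaleDl h : {morph cohom_scale^~ h : a b / a + b}.
Proof. by move=> a b; rewrite -[h]coclassK !coclass_scale -coclassD scalerDl. Qed.

HB.instance Definition _ := GRing.Zmodule_isLmodule.Build A cohomology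
  cohom_scaleA cohom_scale1 cohom_scaleDr cohom_scaleDl.

Fact coclass_is_linear : linear coclass.
Proof. by move=> a x y; rewrite coclassD -coclass_scale. Qed.

HB.instance Definition _ :=
  GRing.isLinear.Build A cocycle cohomology *:%R coclass coclass_is_linear.

End Cohomology.

Section CohomologyMap.
Variables (A : comPzRingType) (C D : cochain A) (phi : chain_map C D) (i : int).

Fact cocycle_map_subproof (z : cocycle C i) : phi i (val z) \in @is_cocycle A D i.
Proof.
rewrite unfold_in cmap_comm; have := valP z; rewrite unfold_in => /eqP ->.
by rewrite linear0.
Qed.

Definition cocycle_map (z : cocycle C i) : cocycle D i :=
  Cocycle (cocycle_map_subproof z).

Definition cohomology_map (h : cohomology C i) : cohomology D i :=
  coclass (cocycle_map (repr h)).

Lemma cohomology_map_coclass z :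
  cohomology_map (coclass z) = coclass (cocycle_map z).
Proof.
apply/coclassP; have /coclassP := coclassK (coclass z).
rewrite !unfold_in => /asboolP[y hy]; apply/asboolP; exists (phi _ y).
by rewrite cmap_comm hy /= linearB.
Qed.

Fact cohomology_map_is_linear : linear cohomology_map.
Proof.
move=> a h k; rewrite -[h]coclassK -[k]coclassK -linearP !cohomology_map_coclass.
by rewrite -linearP; congr coclass; apply: val_inj; rewrite /= linearP.
Qed.

HB.instance Definition _ := GRing.isLinear.Build A (cohomology C i) (cohomology D i)
  *:%R cohomology_map cohomology_map_is_linear.

End CohomologyMap.

Definition quasi_iso (A : comPzRingType) (C D : cochain A) (phi : chain_map C D) : Prop :=
  forall i, bijective (cohomology_map phi (i := i)).

Record injective_resolution (A : comPzRingType) (C : cochain A) := InjectiveResolution {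
  ir_cochain :> cochain A;
  ir_map : chain_map C ir_cochain;
  ir_injective : forall i, injective_module (ir_cochain i);
  ir_bounded_below : exists n : int, forall i, i < n -> forall x : ir_cochain i, x = 0;
  ir_quasi_iso : quasi_iso ir_map
}.

Section HomComplex.
Variables (A : comPzRingType) (N : lmodType A) (E : cochain A).

Definition Hom_cochain : cochain A.
Proof.
refine (@Cochain A (fun i => Hom N (E i))
          (fun i j => hom_post (X := N) (cdiff E i j) : {linear _ -> _}) _ _).
- by move=> i j ij f; apply: hom_ext => x /=; rewrite cdiff_shape.
- by move=> i j k f; apply: hom_ext => x /=; rewrite cdiff_cdiff.
Defined.

End HomComplex.

Section Koszul.
Variables (A : comPzRingType) (m : nat) (u : 'I_m -> A).

(* [koszul_module p] is the [p]-th exterior power of [A^m] in the basis [e_S]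
   indexed by the [p]-element subsets [S] of ['I_m]; it is zero for [p < 0]
   and for [p > m]. *)
Definition koszul_basis (p : int) : finType := {S : {set 'I_m} | (#|S|%:Z == p)%R}.
Definition koszul_module (p : int) : lmodType A := {ffun koszul_basis p -> A^o}.

Definition koszul_sign (S : {set 'I_m}) (j : 'I_m) : A :=
  (-1) ^+ #|[set k in S | (k < j)%N]|.

(* The coefficient of [e_T] in [d e_S = \sum_(j in S) (+/- u_j) e_(S \ j)]. *)
Definition koszul_coef (S T : {set 'I_m}) : A :=
  \sum_(j in S | T == S :\ j) koszul_sign S j * u j.

Definition koszul_diff (p q : int) (c : koszul_module p) : koszul_module q :=
  [ffun T => \sum_(S : koszul_basis p) koszul_coef (val S) (val T) * c S].

Fact koszul_diff_is_linear p q : linear (@koszul_diff p q).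
Proof.
move=> a x y; apply/ffunP => T; rewrite !ffunE scaler_sumr -big_split /=.
apply: eq_bigr => S _; rewrite !ffunE mulrDr; congr (_ + _).
exact: mulrCA.
Qed.

HB.instance Definition _ p q :=
  GRing.isLinear.Build A (koszul_module p) (koszul_module q) *:%R
    (@koszul_diff p q) (@koszul_diff_is_linear p q).

Lemma koszul_coef_eq0 (p q : int) (S : koszul_basis p) (T : koszul_basis q) :
  q + 1 != p -> koszul_coef (val S) (val T) = 0.
Proof.
move=> pq; apply: big_pred0 => j; apply/negP => /andP[jS /eqP TS].
move/eqP: pq; apply; have /eqP <- := valP S; have /eqP <- := valP T.
by rewrite TS (cardsD1 j (val S)) jS addnC PoszD.
Qed.

Lemma koszul_sign_swap (S : {set 'I_m}) (j k : 'I_m) :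
  j \in S -> k \in S -> (k < j)%N ->
  koszul_sign S j * koszul_sign (S :\ j) k = - (koszul_sign S k * koszul_sign (S :\ k) j).
Proof.
move=> jS kS kj; rewrite /koszul_sign.
have -> : [set l in S :\ j | (l < k)%N] = [set l in S | (l < k)%N].
  apply/setP => l; rewrite !inE; case: eqP => //= ->.
  by rewrite ltnNge ltnW ?andbF.
have -> : [set l in S :\ k | (l < j)%N] = [set l in S | (l < j)%N] :\ k.
  by apply/setP => l; rewrite !inE andbA.
rewrite (cardsD1 k [set l in S | (l < j)%N]) inE kS kj /= exprS mulN1r mulNr.
by rewrite mulrC.
Qed.

Lemma koszul_coef_rem (R T : {set 'I_m}) :
  \sum_(j in R) koszul_sign R j * u j * koszul_coef (R :\ j) T = 0.
Proof.
pose P j k := [&& j \in R, k \in R, k != j & T == R :\ j :\ k].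
pose G j k := if P j k then koszul_sign R j * koszul_sign (R :\ j) k * (u j * u k) else 0.
have GN (j k : 'I_m) : (k < j)%N -> G j k + G k j = 0.
  move=> kj; rewrite /G /P [j == k]eq_sym.
  rewrite [R :\ k :\ j]finset.setDDl finset.setUC -finset.setDDl.
  rewrite andbCA; case: ifP => [/and4P[jR kR _ _]|_]; last by rewrite addr0.
  by rewrite koszul_sign_swap // mulNr [u k * u j]mulrC addNr.
have -> : \sum_(j in R) koszul_sign R j * u j * koszul_coef (R :\ j) T
    = \sum_j \sum_k G j k.
  rewrite big_mkcond; apply: eq_bigr => j _; case: ifP => jR; last first.
    by rewrite big1 // => k _; rewrite /G /P jR.
  rewrite /koszul_coef mulr_sumr big_mkcond; apply: eq_bigr => k _.
  rewrite /G /P jR !inE -andbA andbCA; case: ifP => // _.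
  by rewrite mulrACA.
rewrite (pair_bigA _ G) /= (bigID (fun jk : 'I_m * 'I_m => (jk.2 < jk.1)%N)) /=.
rewrite [X in _ + X](bigID (fun jk : 'I_m * 'I_m => (jk.1 < jk.2)%N)) /=.
rewrite [X in _ + (_ + X)]big1 ?addr0 => [|[j k] /= /andP[kj jk]]; last first.
  suff /eqP jEk : j == k by rewrite /G /P jEk eqxx /= !andbF.
  by rewrite -(inj_eq val_inj) /= eqn_leq leqNgt kj leqNgt jk.
pose sw (jk : 'I_m * 'I_m) := (jk.2, jk.1).
have swK : involutive sw by case.
rewrite [X in _ + X](reindex_inj (inv_inj swK)) /=.
rewrite [X in _ + X](eq_bigl (fun jk : 'I_m * 'I_m => (jk.2 < jk.1)%N)) => [|[j k] /=].
  by rewrite -big_split big1 // => -[j k] /= kj; exact: GN.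
by rewrite -leqNgt; case: ltnP => kj; rewrite ?andbF // ltnW.
Qed.

Lemma koszul_coef_coef (p q r : int) (R : koszul_basis p) (T : koszul_basis r) :
  \sum_(S : koszul_basis q) koszul_coef (val R) (val S) * koszul_coef (val S) (val T) = 0.
Proof.
have [qp|qp] := eqVneq (q + 1) p; last first.
  by rewrite big1 // => S _; rewrite koszul_coef_eq0 // mul0r.
rewrite -[RHS](koszul_coef_rem (val R) (val T)).
under eq_bigr => S _ do rewrite {1}/koszul_coef mulr_suml.
rewrite (exchange_big_dep (fun j => j \in val R)) /=; last by move=> S j _ /andP[].
apply: eq_bigr => j jR.
have cardRj : #|val R :\ j|%:Z == q.
  have /eqP := valP R; rewrite (cardsD1 j (val R)) jR addnC PoszD.
  by move=> cardR; apply/eqP/(addIr 1); rewrite qp.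
rewrite (big_pred1 (exist (fun S : {set 'I_m} => #|S|%:Z == q) _ cardRj)) // => S.
by rewrite -val_eqE /= jR.
Qed.

Fact koszul_diff_diff p q r (c : koszul_module p) :
  koszul_diff r (koszul_diff q c) = 0.
Proof.
apply/ffunP => T; rewrite !ffunE.
under eq_bigr => S _ do rewrite ffunE mulr_sumr.
rewrite exchange_big big1 //= => R _.
under eq_bigr => S _ do rewrite mulrA [koszul_coef _ _ * koszul_coef _ _]mulrC.
by rewrite -mulr_suml koszul_coef_coef mul0r.
Qed.

Variable M : lmodType A.

(* No sign is added to precomposition with the Koszul differential. For [m = 0]
   the complex is [Hom(A, M)], i.e. [M], placed in degree [0]. *)
Definition koszul_cochain : cochain A.
Proof.
refine (@Cochain A (fun p => Hom (koszul_module p) M)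
  (fun p q => hom_pre (Y := M) (@koszul_diff q p : {linear _ -> _}) : {linear _ -> _})
  _ _).
- move=> p q pq f; apply: hom_ext => c /=.
  rewrite [X in f X](_ : _ = 0) ?linear0 //.
  apply/ffunP => T; rewrite !ffunE big1 // => S _.
  by rewrite koszul_coef_eq0 ?mul0r.
- by move=> p q r f; apply: hom_ext => c /=; rewrite koszul_diff_diff linear0.
Defined.

End Koszul.

Section DirectSum.
Variables (A : comPzRingType) (V : int -> lmodType A).

Definition dirprod : Type := forall i, V i.
Implicit Types f g h : dirprod.

HB.instance Definition _ := Choice.on dirprod.

Fact dirprod_addA : associative (fun f g : dirprod => (fun i => f i + g i) : dirprod).
Proof. by move=> f g h; apply/functional_extensionality_dep => i; rewrite addrA. Qed.
Fact dirprod_addC : commutative (fun f g : dirprod => (fun i => f i + g i) : dirprod).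
Proof. by move=> f g; apply/functional_extensionality_dep => i; rewrite addrC. Qed.
Fact dirprod_add0 :
  left_id ((fun=> 0) : dirprod) (fun f g : dirprod => (fun i => f i + g i) : dirprod).
Proof. by move=> f; apply/functional_extensionality_dep => i; rewrite add0r. Qed.
Fact dirprod_addN : left_inverse ((fun=> 0) : dirprod)
  (fun f : dirprod => (fun i => - f i) : dirprod)
  (fun f g : dirprod => (fun i => f i + g i) : dirprod).
Proof. by move=> f; apply/functional_extensionality_dep => i; rewrite addNr. Qed.

HB.instance Definition _ :=
  GRing.isZmodule.Build dirprod dirprod_addA dirprod_addC dirprod_add0 dirprod_addN.

Definition dirprod_scale (a : A) f : dirprod := fun i => a *: f i.

Fact dirprod_scaleA a b f : dirprod_scale a (dirprod_scale b f) = dirprod_scale (a * b) f.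
Proof. by apply/functional_extensionality_dep => i; rewrite /dirprod_scale scalerA. Qed.
Fact dirprod_scale1 : left_id 1 dirprod_scale.
Proof.
by move=> f; apply/functional_extensionality_dep => i; rewrite /dirprod_scale scale1r.
Qed.
Fact dirprod_scaleDr : right_distributive dirprod_scale +%R.
Proof.
by move=> a f g; apply/functional_extensionality_dep => i; rewrite /dirprod_scale scalerDr.
Qed.
Fact dirprod_scaleDl f : {morph dirprod_scale^~ f : a b / a + b}.
Proof.
by move=> a b; apply/functional_extensionality_dep => i; rewrite /dirprod_scale scalerDl.
Qed.

HB.instance Definition _ := GRing.Zmodule_isLmodule.Build A dirprod
  dirprod_scaleA dirprod_scale1 dirprod_scaleDr dirprod_scaleDl.

Definition finitely_supported : {pred dirprod} :=
  fun f => `[< finite_set [set i | f i <> 0] >].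

Fact finitely_supported_submod : submod_closed finitely_supported.
Proof.
split=> [|a f g]; rewrite !unfold_in.
  by apply/asboolP; apply: sub_finite_set (@finite_set0 int) => i /=.
move=> /asboolP Ff /asboolP Fg; apply/asboolP.
have : finite_set ([set i | f i <> 0] `|` [set i | g i <> 0]) by rewrite finite_setU.
apply: sub_finite_set => i fg.
have [fi|/eqP fi] := eqVneq (f i) 0; last by left.
have [gi|/eqP gi] := eqVneq (g i) 0; last by right.
by case: fg; change (a *: f i + g i = 0); rewrite fi gi scaler0 addr0.
Qed.

HB.instance Definition _ :=
  GRing.isSubmodClosed.Build A dirprod finitely_supported finitely_supported_submod.

Record dirsum := DirSum { dirsum_val : dirprod; _ : dirsum_val \in finitely_supported }.

HB.instance Definition _ := [isSub of dirsum for dirsum_val].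
HB.instance Definition _ := [Choice of dirsum by <:].
HB.instance Definition _ := [SubChoice_isSubLmodule of dirsum by <:].

End DirectSum.

(* [V^i(u, N, M)] is computed from a given injective resolution [E] of the
   Koszul cochain complex; another choice of [E] gives an isomorphic module. *)
Section V.
Variables (A : comPzRingType) (m : nat) (u : 'I_m -> A) (N M : lmodType A).
Variable E : injective_resolution (koszul_cochain u M).

Definition Vmod (i : int) : lmodType A := cohomology (Hom_cochain N E) i.

Definition Vstar : lmodType A := dirsum Vmod.

End V.

Arguments Vmod {A m} u N M E i.
Arguments Vstar {A m} u N M E.

Definition drop_last (A : Type) (m : nat) (u : 'I_m.+1 -> A) : 'I_m -> A :=
  fun i => u (widen_ord (leqnSn m) i).

Definition exact_at (A : comPzRingType) (X Y Z : lmodType A) (f : X -> Y) (g : Y -> Z) :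
    Prop := range f = g @^-1` [set 0].

(* Main.v *)
(** Extending from a quasi-isomorphism to a bounded below complex of injectives
    is possible, and unique, up to homotopy: the cone of the quasi-isomorphism
    is acyclic, and every map from an acyclic complex to such a complex is
    null-homotopic. Hence every homotopy on the Koszul complex [K(u, M)]
    transports to its resolution [E]. As [u_j] is null-homotopic on [K(u, M)]
    and [ann M] acts on it by zero, both kill [V]; [ann N] already kills
    [Hom(N, E)].
    For the exact sequence, [K(u, M)] shifted by one is isomorphic to the cocone
    of [u_m] on [K(u', M)], so it is resolved by the cocone of [u_m] on the
    resolution [E'] of [K(u', M)]. The shift of [E] is therefore homotopy
    equivalent to that cocone, and this equivalence survives [Hom(N, -)]. *)

From HB Require Import structures.
From mathcomp Require Import all_boot all_order all_algebra.
From mathcomp Require Import all_classical.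
From mathcomp Require Import zify.
Require Import Defs.

Set Implicit Arguments.
Unset Strict Implicit.
Unset Printing Implicit Defensive.

Import Order.TTheory GRing.Theory Num.Theory.
Local Open Scope classical_set_scope.
Local Open Scope ring_scope.

(** * Equalities in abelian groups by reflection *)

Section ZmodNormalization.
Variable V : zmodType.

Inductive zexp := ZVar of nat | ZZero | ZAdd of zexp & zexp | ZOpp of zexp.

Fixpoint zeval (env : seq V) (e : zexp) : V :=
  match e with
  | ZVar n => env`_n
  | ZZero => 0
  | ZAdd e1 e2 => zeval env e1 + zeval env e2
  | ZOpp e1 => - zeval env e1
  end.

Fixpoint zcoef (e : zexp) (k : nat) : int :=
  match e with
  | ZVar n => (n == k)%:Z
  | ZZero => 0
  | ZAdd e1 e2 => zcoef e1 k + zcoef e2 k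
  | ZOpp e1 => - zcoef e1 k
  end.

Lemma zevalE env e : zeval env e = \sum_(k < size env) env`_k *~ zcoef e k.
Proof.
elim: e => [n||e1 IH1 e2 IH2|e IH] /=.
- case: (ltnP n (size env)) => [n_lt|n_ge]; last first.
    rewrite nth_default // big1 // => k _; case: eqP => [nk|_]; last by rewrite mulr0z.
    by move: (ltn_ord k); rewrite -nk ltnNge n_ge.
  rewrite (bigD1 (Ordinal n_lt)) //= eqxx mulr1z big1 ?addr0 // => k.
  by rewrite -val_eqE /= eq_sym => /negPf ->; rewrite mulr0z.
- by rewrite big1 // => k _; rewrite mulr0z.
- by rewrite IH1 IH2 -big_split; apply: eq_bigr => k _; rewrite mulrzDr.
- by rewrite IH -sumrN; apply: eq_bigr => k _; rewrite mulrNz.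
Qed.

(** The integer coefficients are computed, so for a formal identity the hypothesis reduces to [true]
    and [isT] proves it. *)
Lemma zeval_eq env e1 e2 :
  all (fun k => zcoef e1 k == zcoef e2 k) (iota 0 (size env)) ->
  zeval env e1 = zeval env e2.
Proof.
move=> /allP h; rewrite !zevalE; apply: eq_bigr => k _.
by rewrite (eqP (h _ _)) // mem_iota add0n ltn_ord.
Qed.

End ZmodNormalization.

Ltac zmod_index x env :=
  match env with
  | ?y :: ?s => match constr:(Set) with
    | _ => let _ := match constr:(Set) with _ => unify x y end in constr:(0%N)
    | _ => let n := zmod_index x s in constr:(n.+1)
    end
  end.

Ltac zmod_atoms env x :=
  match x with
  | (?y + ?z)%R => let env' := zmod_atoms env y in zmod_atoms env' z
  | (- ?y)%R => zmod_atoms env y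
  | 0%R => env
  | _ => match constr:(Set) with
    | _ => let _ := zmod_index x env in env
    | _ => constr:(x :: env)
    end
  end.

Ltac zmod_reify env x :=
  match x with
  | (?y + ?z)%R => let e := zmod_reify env y in let f := zmod_reify env z in constr:(ZAdd e f)
  | (- ?y)%R => let e := zmod_reify env y in constr:(ZOpp e)
  | 0%R => constr:(ZZero)
  | _ => let n := zmod_index x env in constr:(ZVar n)
  end.

(* Decides equalities that hold in every abelian group. *)
Ltac zmod :=
  rewrite /=;
  match goal with |- @eq ?V ?x ?y =>
    let env := zmod_atoms (@nil V) x in
    let env := zmod_atoms env y in
    let e := zmod_reify env x in
    let f := zmod_reify env y in
    exact: (@zeval_eq _ env e f isT)
  end.

(** * Injective modules and null-homotopies *)

(** Bundles linear maps that are built in the middle of a proof. *)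
Definition mklin (A : comPzRingType) (X Y : lmodType A) (f : X -> Y)
    (lf : linear f) : {linear X -> Y} :=
  HB.pack f (GRing.isLinear.Build A X Y *:%R f lf).

Lemma linear_pair (A : comPzRingType) (U X Y : lmodType A) (f : U -> X) (g : U -> Y) :
  linear f -> linear g -> linear (fun x => (f x, g x)).
Proof. by move=> lf lg a x y; congr pair; [exact: lf | exact: lg]. Qed.

Section Injections.
Variables (A : comPzRingType) (X Y : lmodType A).

Fact pair_l_is_linear : linear (fun x : X => (x, 0) : X * Y).
Proof. by apply: linear_pair => [//|a x y]; rewrite scaler0 addr0. Qed.
Definition pair_l := mklin pair_l_is_linear.

Fact pair_r_is_linear : linear (fun y : Y => (0, y) : X * Y).
Proof. by apply: linear_pair => [a x y|//]; rewrite scaler0 addr0. Qed.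
Definition pair_r := mklin pair_r_is_linear.

Lemma pair_lr (x : X) (y : Y) : (x, y) = pair_l x + pair_r y :> X * Y.
Proof. by congr pair; rewrite /= ?addr0 ?add0r. Qed.

End Injections.
Arguments pair_l {A X Y}.
Arguments pair_r {A X Y}.

Section Factorization.
Variables (A : comPzRingType) (X Y : lmodType A) (f : {linear X -> Y}).

Definition in_image : {pred Y} := fun y => `[< exists x, f x = y >].

Fact in_image_submod : submod_closed in_image.
Proof.
split=> [|a x y]; rewrite !unfold_in.
  by apply/asboolP; exists 0; rewrite linear0.
move=> /asboolP[x' <-] /asboolP[y' <-]; apply/asboolP; exists (a *: x' + y').
by rewrite linearP.
Qed.

HB.instance Definition _ := GRing.isSubmodClosed.Build A Y in_image in_image_submod.

Record image_module := ImageModule { image_val : Y; _ : image_val \in in_image }.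

HB.instance Definition _ := [isSub of image_module for image_val].
HB.instance Definition _ := [Choice of image_module by <:].
HB.instance Definition _ := [SubChoice_isSubLmodule of image_module by <:].

(** As [g] kills the kernel of [f], it induces a map on the image of [f]; injectivity of [E] extends
    that map along the inclusion of the image into [Y]. *)
Lemma injective_factor (E : lmodType A) (g : {linear X -> E}) :
  injective_module E -> (forall x, f x = 0 -> g x = 0) ->
  exists h : {linear Y -> E}, forall x, h (f x) = g x.
Proof.
move=> Einj fg0.
have fg x x' : f x = f x' -> g x = g x'.
  move=> e; apply/eqP; rewrite -subr_eq0 -linearB; apply/eqP/fg0.
  by rewrite linearB e subrr.
(* The induced map goes through a chosen preimage; by [fg] the choice does not matter. *)
have im_ex (y : image_module) : {x | f x = val y}.
  by apply: cid; have := valP y; rewrite unfold_in => /asboolP.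
pose g' y := g (projT1 (im_ex y)).
have g'P x y : f x = val y -> g' y = g x.
  by move=> e; apply: fg; rewrite (projT2 (im_ex y)).
have g'lin : linear g'.
  move=> a y z; rewrite -linearP; apply: g'P.
  by rewrite linearP (projT2 (im_ex y)) (projT2 (im_ex z)) linearP.
have [h hP] := Einj _ _ (val : {linear image_module -> Y}) (mklin g'lin) val_inj.
exists h => x.
have fx : f x \in in_image by rewrite unfold_in; apply/asboolP; exists x.
by have := hP (ImageModule fx); rewrite /= => ->; apply: g'P.
Qed.

End Factorization.

Lemma injective_prod (A : comPzRingType) (X Y : lmodType A) :
  injective_module X -> injective_module Y -> injective_module (X * Y)%type.
Proof.
move=> Xinj Yinj U V f g finj.
have l1 : linear (fun u => (g u).1) by move=> a u v; rewrite linearP.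
have l2 : linear (fun u => (g u).2) by move=> a u v; rewrite linearP.
have [h1 h1P] := Xinj _ _ f (mklin l1) finj.
have [h2 h2P] := Yinj _ _ f (mklin l2) finj.
exists (mklin (linear_pair (linearP h1) (linearP h2))) => x.
by rewrite /= h1P h2P /=; case: (g x).
Qed.

(* With differentials [C i -> C (i + 1)] only, shifts and cones need no
   transport along equations between degrees. *)
Record complex (A : comPzRingType) := Complex {
  obj :> int -> lmodType A;
  d : forall i : int, {linear obj i -> obj (i + 1)};
  dd : forall i x, d (i + 1) (d i x) = 0
}.
Arguments d {A} c i.
Arguments dd {A} c i x.

(** Some families of maps are first obtained in degrees [i + 1] only. This reindexes them to all
    degrees and hides the transport along [i - 1 + 1 = i]. *)
Lemma unshift_family (P : int -> Type) (g : forall i, P (i + 1)) :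
  {g' : forall i, P i | forall i, g' (i + 1) = g i}.
Proof.
exists (fun i => ecast i (P i) (subrK 1 i) (g (i - 1))) => i.
(* Once [i + 1 - 1] is generalised to [j], the equation gives [j = i]; equality proofs between
   integers are unique, so the cast is trivial. *)
move: (i + 1 - 1) (subrK 1 (i + 1)) => j e.
by move: (e); rewrite -(addIr _ e) => e'; rewrite (eq_irrelevance e' erefl).
Qed.

Lemma int_succ (i : int) : exists j, i = j + 1.
Proof. by exists (i - 1); rewrite subrK. Qed.

Section Complexes.
Variable A : comPzRingType.
Implicit Types C D E Z : complex A.

Definition family C D := forall i : int, {linear C i -> D i}.

Definition is_chain C D (f : family C D) : Prop :=
  forall i x, d D i (f i x) = f (i + 1) (d C i x).

(** The relation [f - g = d h + h d] is written in degree [i + 1], where all the maps compose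
    without transport; by [int_succ] this covers every degree. Bare functions are allowed, so
    composites and scalings need no bundling. *)
Definition homotopic C D (f g : forall i : int, C i -> D i) : Prop :=
  exists h : forall i : int, {linear C (i + 1) -> D i}, forall i x,
    f (i + 1) x = g (i + 1) x + (d D i (h i x) + h (i + 1) (d C (i + 1) x)).

Definition acyclic Z : Prop :=
  forall i (x : Z (i + 1)), d Z (i + 1) x = 0 -> exists y, d Z i y = x.

Definition bounded_below C : Prop :=
  exists n : int, forall i, i < n -> forall x : C i, x = 0.

Definition injective_complex C : Prop := forall i, injective_module (C i).

(** Bijectivity on cohomology, said with elements so that no quotient is formed: the first clause is
    injectivity, the second surjectivity. *)
Definition qis C D (s : family C D) : Prop :=
  (forall i (x : C (i + 1)) (y : D i), d C (i + 1) x = 0 -> s (i + 1) x = d D i y ->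
     exists z, x = d C i z) /\
  (forall i (y : D (i + 1)), d D (i + 1) y = 0 ->
     exists x w, d C (i + 1) x = 0 /\ y = s (i + 1) x + d D i w).

Lemma homotopic_trans C D (f g k : forall i : int, C i -> D i) :
  homotopic f g -> homotopic g k -> homotopic f k.
Proof.
case=> h hP [h' h'P].
have l i : linear (fun x => h' i x + h i x).
  by move=> a x y; rewrite !linearP scalerDr addrACA.
exists (fun i => mklin (l i)) => i x /=.
by rewrite hP h'P linearD -addrA addrACA.
Qed.

Lemma homotopic_post C D E (f g : forall i : int, C i -> D i) (b : family D E) :
  is_chain b -> homotopic f g ->
  homotopic (fun i x => b i (f i x)) (fun i x => b i (g i x)).
Proof.
move=> bc [h hP].
exists (fun i => b i \o h i : {linear _ -> _}) => i x /=.
by rewrite hP !linearD bc.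
Qed.

(** The homotopy is built by induction on the degree, starting where [E] is still zero. At each
    stage [f - d h] vanishes on boundaries, hence on all cocycles of the acyclic [Z], so by
    injectivity it factors through the differential of [Z]; the factor is the next member of the
    homotopy. *)
Lemma null_homotopic_acyclic Z E (f : family Z E) :
  acyclic Z -> injective_complex E -> bounded_below E -> is_chain f ->
  homotopic f (fun i _ => 0).
Proof.
move=> Zac Einj [n En] fc.
pose H := forall i : int, {linear Z (i + 1) -> E i}.
(* [R h i] is the wanted relation in degree [i + 1]; [Q h i] is the condition under which [h] can be
   changed in degree [i + 1] to satisfy it. *)
pose Q (h : H) (i : int) := forall x : Z i, d E i (f i x - h i (d Z i x)) = 0.
pose R (h : H) (i : int) := forall x : Z (i + 1),
  f (i + 1) x = d E i (h i x) + h (i + 1) (d Z (i + 1) x).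
have RQ h i : R h i -> Q h (i + 1) by move=> r x; rewrite r addrK dd.
have step (h : H) i : Q h i ->
    exists h' : H, (forall j, j != i + 1 -> h' j = h j) /\ R h' i.
  move=> q.
  have l : linear (fun x => f (i + 1) x - d E i (h i x)).
    by move=> a x y; rewrite !linearP /= scalerDr addrACA.
  have [|k kP] := @injective_factor _ _ _ (d Z (i + 1)) _ (mklin l) (@Einj _).
    move=> x /Zac[y <-] /=; rewrite -fc -linearB.
    exact: q.
  exists (@dfwith _ _ h (i + 1) k); split=> [j ji|x]; first by rewrite dfwithout // eq_sym.
  rewrite dfwithin dfwithout; last by rewrite -subr_eq0 addrAC subrr add0r.
  by rewrite kP /= [RHS]addrC subrK.
have nxt h i : {h' : H | Q h i -> (forall j, j != i + 1 -> h' j = h j) /\ R h' i}.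
  apply: cid; have [/step[h' h'P]|nq] := pselect (Q h i); first by exists h'.
  by exists h => /nq.
(* Then [E (b + 1)] is zero, so [Q] holds in degree [b] for the zero family. *)
pose b : int := n - 2.
pose h_ := fix h_ (k : nat) : H :=
  if k is k'.+1 then projT1 (nxt (h_ k') (b + k'%:Z))
  else fun i => (\0 : {linear _ -> _}).
have bS k : b + k.+1%:Z = b + k%:Z + 1 by rewrite -[k.+1]addn1 PoszD addrA.
have h_P k : Q (h_ k) (b + k%:Z).
  elim: k => [|k IH] x.
    apply: En; rewrite addr0 /b; lia.
  move: x; rewrite bS; apply: RQ.
  by have [] := projT2 (nxt (h_ k) (b + k%:Z)) IH.
(* Stage [k] fixes the member of degree [b + k] for good, so the diagonal is taken. Below [b] the
   stage is meaningless, but there the relation lives in a zero module. *)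
exists (fun i => h_ (absz (i - b)%R) i) => i x; rewrite add0r.
have [ib|ib] := ltP i b.
  have Ei y : y = 0 :> E (i + 1).
    apply: En; move: ib; rewrite /b; lia.
  by rewrite [LHS]Ei [RHS]Ei.
have [k ik] : exists k : nat, i = b + k%:Z.
  by exists (absz (i - b)%R); lia.
subst i; have absb (k' : nat) : absz (b + k'%:Z - b)%R = k' by rewrite addrAC subrr add0r.
rewrite absb (_ : absz (b + k%:Z + 1 - b)%R = k.+1); last by rewrite -bS absb.
have [agree r] := projT2 (nxt (h_ k) (b + k%:Z)) (h_P k).
by rewrite -agree; [exact: r | lia].
Qed.

End Complexes.

(** * Comparison of resolutions *)

Section Cone.
Variables (A : comPzRingType) (C D : complex A) (s : family C D).

Definition cone_diff i (x : C (i + 1) * D i) : C (i + 1 + 1) * D (i + 1) :=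
  (- d C (i + 1) x.1, s (i + 1) x.1 + d D i x.2).

Fact cone_diff_is_linear i : linear (@cone_diff i).
Proof.
apply: linear_pair => a x y; rewrite !linearP //=.
by rewrite scalerDr addrACA.
Qed.

Hypothesis sc : is_chain s.

Fact cone_dd i x :
  mklin (@cone_diff_is_linear (i + 1)) (mklin (@cone_diff_is_linear i) x) = 0.
Proof.
rewrite /= /cone_diff /= linearN dd !oppr0; congr pair.
by rewrite linearD linearN sc dd addr0 addNr.
Qed.

Definition cone : complex A := Complex cone_dd.

(** For a cocycle [(c, y)], injectivity on cohomology makes [c] the boundary of some [c']; then
    [y + s c'] is a cocycle, and surjectivity writes it as the image of a cocycle plus a
    boundary. *)
Lemma cone_acyclic : qis s -> acyclic cone.
Proof.
move=> [s_inj s_surj] i [c y] [/eqP]; rewrite oppr_eq0 => /eqP dc /eqP.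
rewrite addr_eq0 -linearN => /eqP dy.
have [c' c'E] := s_inj _ _ _ dc dy.
have [|c'' [w [dc'' yE]]] := s_surj _ (y + s (i + 1) c').
  by rewrite linearD sc -c'E dy linearN subrr.
exists (c'' - c', w); congr pair => /=.
  by rewrite linearB dc'' sub0r opprK.
by rewrite linearB addrAC -yE addrK.
Qed.

End Cone.

Section Shift.
Variables (A : comPzRingType) (C : complex A).

Fact shift_dd i x : d C (i + 1 + 1) (d C (i + 1) x) = 0.
Proof. exact: dd. Qed.

Definition shift : complex A := @Complex A (fun i => C (i + 1)) (fun i => d C (i + 1)) shift_dd.

(** The sign matches the first component of [cone_diff], so that a chain map on [C], read on the
    first factor of the cone, is a chain map into [neg_shift]. *)
Definition neg_shift_diff i : {linear C (i + 1) -> C (i + 1 + 1)} :=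
  GRing.Linear.clone _ _ _ _ (\- d C (i + 1)) _.

Fact neg_shift_dd i x : neg_shift_diff (i + 1) (neg_shift_diff i x) = 0.
Proof. by rewrite /= linearN opprK dd. Qed.

Definition neg_shift : complex A := @Complex A (fun i => C (i + 1)) neg_shift_diff neg_shift_dd.

Lemma bounded_below_pred : bounded_below C -> exists n : int, forall i, i < n ->
  (forall x : C i, x = 0) /\ (forall x : C (i + 1), x = 0).
Proof.
move=> [n nP]; exists (n - 1) => i i_n; split=> x; apply: nP; move: i_n; lia.
Qed.

End Shift.

Section Comparison.
Variables (A : comPzRingType) (C D E : complex A) (s : family C D).
Hypotheses (sc : is_chain s) (sq : qis s).
Hypotheses (Einj : injective_complex E) (Ebd : bounded_below E).

(** Projecting the cone of [s] to its first factor and applying [f] gives a chain map into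
    [neg_shift E], which is null-homotopic. The null-homotopy restricted to the [D] factor is the
    extension [g]; restricted to the [C] factor it is the homotopy between [g s] and [f]. *)
Lemma qis_lift (f : family C E) : is_chain f ->
  exists g : family D E, is_chain g /\ homotopic (fun i x => g i (s i x)) f.
Proof.
move=> fc.
have lphi i : linear (fun x : cone sc i => f (i + 1) x.1 : neg_shift E i).
  by move=> a x y; rewrite linearP.
have [||k kP] := @null_homotopic_acyclic _ _ (neg_shift E) (fun i => mklin (lphi i))
    (cone_acyclic sq) (fun i => @Einj (i + 1)).
- by have [n nP] := bounded_below_pred Ebd; exists n => i /nP[].
- by move=> i x; rewrite /= linearN fc.
pose g0 i : {linear D (i + 1) -> E (i + 1)} := k i \o pair_r.
pose h0 i : {linear C (i + 1 + 1) -> E (i + 1)} := k i \o pair_l.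
have [g gE] := @unshift_family (fun i => {linear D i -> E i}) g0.
have [h hE] := @unshift_family (fun i => {linear C (i + 1) -> E i}) h0.
exists g; split=> [i x|].
  have [j ij] := int_succ i; subst i; rewrite !gE /g0 /=.
  have /= := kP j (0, x); rewrite !linear0 add0r => /esym /eqP.
  rewrite addr_eq0 eqr_opp => /eqP ->; congr (k _ _); congr pair => /=.
    by rewrite linear0 oppr0.
  by rewrite linear0 add0r.
exists h => i x; have [j ij] := int_succ i; subst i; rewrite !hE !gE.
have /= -> := kP j (x, 0).
rewrite add0r /cone_diff linear0 addr0 [(- _, _)]pair_lr linearD !linearN /=.
by rewrite [RHS]addrACA addNr add0r [RHS]addrAC addNr add0r.
Qed.

(** The homotopy [h] between the restrictions is exactly what makes [(c, y) |-> g y - g' y + h c] a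
    chain map on the cone. A null-homotopy of it, restricted to [D], joins [g] to [g']. *)
Lemma qis_homotopic (g g' : family D E) : is_chain g -> is_chain g' ->
  homotopic (fun i x => g i (s i x)) (fun i x => g' i (s i x)) -> homotopic g g'.
Proof.
move=> gc g'c [h hP].
pose phi i : {linear cone sc i -> E i} :=
  GRing.Linear.clone _ _ _ _ (((g i \- g' i) \o snd) \+ (h i \o fst)) _.
have [|k kP] := @null_homotopic_acyclic _ _ E phi
    (cone_acyclic sq) Einj Ebd.
- move=> i x; rewrite /= /cone_diff /= !linearD !linearN gc g'c hP.
  by zmod.
exists (fun i => k i \o pair_r : {linear _ -> _}) => i x.
have /= := kP i (0, x); rewrite add0r linear0 addr0 => /eqP.
rewrite subr_eq => /eqP ->; rewrite /cone_diff /= !linear0 add0r.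
by zmod.
Qed.

End Comparison.

(** * The cocone of a homothety *)

Section Cocone.
Variables (A : comPzRingType) (a : A) (C : complex A).

(** Everything sits one degree lower than in the usual cocone, hence the later comparison with a
    [shift]. *)
Definition cocone_diff i (x : C (i + 1) * C i) : C (i + 1 + 1) * C (i + 1) :=
  (d C (i + 1) x.1, a *: x.1 - d C i x.2).

Fact cocone_diff_is_linear i : linear (@cocone_diff i).
Proof.
apply: linear_pair => b x y; rewrite ?linearP //=.
by rewrite scalerA mulrC -scalerA; zmod.
Qed.

Fact cocone_dd i x :
  mklin (@cocone_diff_is_linear (i + 1)) (mklin (@cocone_diff_is_linear i) x) = 0.
Proof.
rewrite /= /cocone_diff /= dd; congr pair.
by rewrite linearB linearZ dd; zmod.
Qed.

Definition cocone : complex A := Complex cocone_dd.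

Lemma cocone_bounded_below : bounded_below C -> bounded_below cocone.
Proof.
move=> /bounded_below_pred[n nP]; exists n => i /nP[C0 C1] [x y].
by rewrite (C0 y) (C1 x).
Qed.

Lemma cocone_injective : injective_complex C -> injective_complex cocone.
Proof. by move=> Cinj i; apply: injective_prod; exact: Cinj. Qed.

End Cocone.

Section CoconeMap.
Variables (A : comPzRingType) (a : A) (C D : complex A) (s : family C D).
Hypothesis sc : is_chain s.

Fact cocone_map_is_linear i :
  linear (fun x : cocone a C i => (s (i + 1) x.1, s i x.2) : cocone a D i).
Proof. by apply: linear_pair => b x y; rewrite linearP. Qed.

Definition cocone_map : family (cocone a C) (cocone a D) :=
  fun i => mklin (@cocone_map_is_linear i).

Lemma cocone_map_chain : is_chain cocone_map.
Proof.
move=> i x; rewrite /= /cocone_diff /=; congr pair; first exact: sc.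
by rewrite linearB linearZ sc.
Qed.

(** The five lemma for cocones, chased on elements: the first component is treated first, and a
    cocycle of [C] then corrects the second. *)
Lemma cocone_map_qis : qis s -> qis cocone_map.
Proof.
move=> [s_inj s_surj]; split.
- move=> i [x y] [e f] /= [dx] /eqP; rewrite subr_eq0 => /eqP axdy [sx sy].
  have [x1 x1E] := s_inj _ _ _ dx sx.
  (* The primitive [x1] of [x] need not map to [e], even up to a boundary; the cocycle [x2] repairs
     this. *)
  have [|x2 [e2 [dx2 eE]]] := s_surj _ (e - s _ x1).
    by rewrite linearB /= sc -x1E sx subrr.
  have [||y4 y4E] := s_inj _ (y - a *: (x1 + x2)) (a *: e2 - f).
  + by rewrite linearB linearZ /= linearD dx2 addr0 -x1E axdy subrr.
  + rewrite linearB sy linearZ /= linearD linearB linearZ /=.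
    rewrite -[e](subrK (s (i + 1) x1)) eE [d _ _ (a *: _)]linearZ /= scalerN !scalerDr.
    by zmod.
  exists (x1 + x2, - y4); rewrite /= /cocone_diff /=; congr pair.
    by rewrite linearD dx2 addr0.
  by rewrite linearN opprK -y4E; zmod.
- move=> i [e f] /= [de] /eqP; rewrite subr_eq0 => /eqP aedf.
  have [x [e1 [dx eE]]] := s_surj _ _ de.
  have [||y yE] := s_inj _ (a *: x) (f - a *: e1).
  + by rewrite linearZ /= dx scaler0.
  + by rewrite linearB !linearZ /= -aedf eE scalerDr scalerN; zmod.
  have [|y2 [f2 [dy2 fE]]] := s_surj _ (f - a *: e1 - s _ y).
    by rewrite !linearB linearZ /= -aedf sc -yE [s _ _]linearZ /= eE scalerDr; zmod.
  exists (x, y + y2), (e1, - f2); split.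
    by rewrite /= /cocone_diff /= dx linearD dy2 yE addr0 subrr.
  rewrite /= /cocone_diff /=; congr pair => /=; first exact: eE.
  rewrite linearD linearN -[f](subrK (a *: e1)) -[f - _](subrK (s (i + 1) y)) fE.
  by zmod.
Qed.

End CoconeMap.

(** * Cohomology of the complexes [Hom(N, E)] *)

Section Cochains.
Variable A : comPzRingType.
Implicit Types C D : cochain A.

Definition of_cochain C : complex A :=
  @Complex A (cobj C) (fun i => cdiff C i (i + 1)) (fun i x => cdiff_cdiff _ _ x).

Definition of_chain_map C D (phi : chain_map C D) : family (of_cochain C) (of_cochain D) :=
  cmap phi.

Lemma of_chain_map_chain C D (phi : chain_map C D) : is_chain (of_chain_map phi).
Proof. by move=> i x; exact: cmap_comm. Qed.

(** Coboundaries in degree [i + 1] are defined from degree [i + 1 - 1]; the criterion replaces that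
    degree by [i], as in [complex]. *)
Lemma coclass_eq0 C i (z : cocycle C (i + 1)) :
  coclass z = 0 <-> exists y, cdiff C i (i + 1) y = val z.
Proof.
have -> : (coclass z = 0) = (coclass z = coclass 0) by rewrite linear0.
rewrite coclassP subr0 unfold_in; split=> [/asboolP|h].
  by rewrite addrK.
by apply/asboolP; rewrite addrK.
Qed.

Lemma quasi_iso_qis C D (phi : chain_map C D) : quasi_iso phi -> qis (of_chain_map phi).
Proof.
move=> phi_q; split=> i.
- move=> x y dx sx.
  have xz : x \in @is_cocycle A C (i + 1) by rewrite unfold_in; apply/eqP.
  have : cohomology_map phi (coclass (Cocycle xz)) = cohomology_map phi 0.
    rewrite linear0 cohomology_map_coclass; apply/coclass_eq0.
    by exists y; rewrite -sx.
  move=> /(bij_inj (phi_q _)) /coclass_eq0[z zE].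
  by exists z; rewrite -[LHS]zE.
- move=> y dy.
  have yz : y \in @is_cocycle A D (i + 1) by rewrite unfold_in; apply/eqP.
  have [g _ gK] := phi_q (i + 1).
  have := gK (coclass (Cocycle yz)); rewrite -[g _]coclassK cohomology_map_coclass.
  set z := repr _ => /eqP; rewrite -subr_eq0 -linearB => /eqP /coclass_eq0[w wE].
  exists (val z), (- w); split.
    by have := valP z; rewrite unfold_in => /eqP.
  by rewrite linearN; rewrite [d _ _ _]wE /=; zmod.
Qed.

End Cochains.

Section HomCohomology.
Variables (A : comPzRingType) (N : lmodType A) (E : cochain A).

Definition hom_val i (z : cocycle (Hom_cochain N E) i) : Hom N (E i) := val z.

Lemma hom_cocycleP i (z : cocycle (Hom_cochain N E) i) x :
  cdiff E i (i + 1) (hom_val z x) = 0.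
Proof.
have : (cdiff (Hom_cochain N E) i (i + 1) (val z) : Hom N (E (i + 1))) = 0.
  by have := valP z; rewrite unfold_in => /eqP.
by move=> /(congr1 (fun f : Hom N (E (i + 1)) => f x)).
Qed.

Lemma hom_cocycle_ex i (f : Hom N (E i)) :
  (forall x, cdiff E i (i + 1) (f x) = 0) ->
  exists z : cocycle (Hom_cochain N E) i, hom_val z = f.
Proof.
move=> df; have fz : (f : Hom_cochain N E i) \in @is_cocycle A (Hom_cochain N E) i.
  by rewrite unfold_in; apply/eqP; apply: hom_ext => x; exact: df.
by exists (Cocycle fz).
Qed.

Lemma hom_coclass_eq0 i (z : cocycle (Hom_cochain N E) (i + 1)) :
  coclass z = 0 <-> exists y : Hom N (E i), forall x, cdiff E i (i + 1) (y x) = hom_val z x.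
Proof.
rewrite coclass_eq0; split=> -[y yE]; exists y.
  by move=> x; rewrite /hom_val -yE.
by apply: hom_ext => x; rewrite /= yE.
Qed.

End HomCohomology.

Section Resolutions.
Variables (A : comPzRingType) (C : cochain A) (E : injective_resolution C).

Definition augmentation : family (of_cochain C) (of_cochain E) := of_chain_map (ir_map E).

Lemma augmentation_chain : is_chain augmentation.
Proof. exact: of_chain_map_chain. Qed.

Lemma augmentation_qis : qis augmentation.
Proof. exact/quasi_iso_qis/ir_quasi_iso. Qed.

Lemma resolution_injective : injective_complex (of_cochain E).
Proof. exact: ir_injective. Qed.

Lemma resolution_bounded_below : bounded_below (of_cochain E).
Proof. exact: ir_bounded_below. Qed.

(** Multiplication by [b] and zero are chain maps of the resolution whose restrictions along the
    augmentation are homotopic, so [qis_homotopic] applies. *)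
Lemma homotopic_scale_resolution (b : A) :
  homotopic (fun i (x : of_cochain C i) => b *: x) (fun i _ => 0) ->
  homotopic (fun i (x : of_cochain E i) => b *: x) (fun i _ => 0).
Proof.
have lb i : linear (fun x : of_cochain E i => b *: x).
  by move=> c x y; rewrite scalerDr !scalerA mulrC.
pose zero i : {linear of_cochain E i -> of_cochain E i} := \0.
move=> bC.
apply: (qis_homotopic augmentation_chain augmentation_qis resolution_injective
  resolution_bounded_below (g := fun i => mklin (lb i)) (g' := zero)).
- by move=> i x; rewrite /= linearZ.
- by move=> i x; rewrite /= linear0.
have [h hP] := homotopic_post augmentation_chain bC.
by exists h => i x; have := hP i x; rewrite /= linearZ linear0.
Qed.

(** The homotopy is linear, so it passes to [Hom(N, E)]: for a cocycle [z], composing [z] with it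
    gives a primitive of [b z]. *)
Lemma cohomology_scale0 (N : lmodType A) (b : A) :
  homotopic (fun i (x : of_cochain C i) => b *: x) (fun i _ => 0) ->
  forall i (v : cohomology (Hom_cochain N E) i), b *: v = 0.
Proof.
move=> /homotopic_scale_resolution[h hP] i; have [j ->] := int_succ i => v.
rewrite -[v]coclassK -linearZ; apply/hom_coclass_eq0.
set z := repr v; exists (hom_post (h j) (hom_val z)) => x /=.
by have /= := hP j (hom_val z x); rewrite hom_cocycleP linear0 addr0 add0r => <-.
Qed.

End Resolutions.

Section HomCohomologyMap.
Variables (A : comPzRingType) (N : lmodType A) (E E' : cochain A) (i j : int).
Variable phi : {linear E i -> E' j}.

Lemma hom_valP (C : cochain A) k (b : A) (z z' : cocycle (Hom_cochain N C) k) x :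
  hom_val (b *: z + z') x = b *: hom_val z x + hom_val z' x.
Proof. by []. Qed.

Lemma hom_valB (C : cochain A) k (z z' : cocycle (Hom_cochain N C) k) x :
  hom_val (z - z') x = hom_val z x - hom_val z' x.
Proof. by []. Qed.

(** Here [phi] lives in a single degree, so the two hypotheses stand in for a chain map. Describing
    [F] through any cocycle [w] equal to [phi z] frees its uses from chosen representatives. *)
Lemma hom_cohomology_map_ex :
  (forall x, cdiff E i (i + 1) x = 0 -> cdiff E' j (j + 1) (phi x) = 0) ->
  (forall (z : cocycle (Hom_cochain N E) i) (w : cocycle (Hom_cochain N E') j),
     (forall x, hom_val w x = phi (hom_val z x)) -> coclass z = 0 -> coclass w = 0) ->
  exists F : {linear cohomology (Hom_cochain N E) i -> cohomology (Hom_cochain N E') j},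
    forall z w, (forall x, hom_val w x = phi (hom_val z x)) -> F (coclass z) = coclass w.
Proof.
move=> phi_coc phi_cob.
have w_ex (z : cocycle (Hom_cochain N E) i) :
    {w : cocycle (Hom_cochain N E') j | forall x, hom_val w x = phi (hom_val z x)}.
  apply: cid; have [|w wE] := @hom_cocycle_ex _ N E' j (hom_post phi (hom_val z)).
    by move=> x; apply: phi_coc; exact: hom_cocycleP.
  by exists w => x; rewrite wE.
pose F (h : cohomology (Hom_cochain N E) i) := coclass (projT1 (w_ex (repr h))).
have FE (z : cocycle (Hom_cochain N E) i) w :
    (forall x, hom_val w x = phi (hom_val z x)) -> F (coclass z) = coclass w.
  move=> wE; apply/eqP; rewrite -subr_eq0 -linearB; apply/eqP.
  apply: (phi_cob (repr (coclass z) - z)).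
    by move=> x; rewrite !hom_valB (projT2 (w_ex _)) wE linearB.
  by rewrite linearB /= coclassK subrr.
have Flin : linear F.
  move=> b h k; rewrite -[h in LHS]coclassK -[k in LHS]coclassK -linearP /F -linearP.
  by apply: FE => x; rewrite !hom_valP !(projT2 (w_ex _)) linearP.
by exists (mklin Flin).
Qed.

End HomCohomologyMap.

Lemma hom_coclass_eq (A : comPzRingType) (N : lmodType A) (E : cochain A) i
    (z w : cocycle (Hom_cochain N E) (i + 1)) (y : Hom N (E i)) :
  (forall x, hom_val z x = hom_val w x + cdiff E i (i + 1) (y x)) -> coclass z = coclass w.
Proof.
move=> zE; apply/eqP; rewrite -subr_eq0 -linearB; apply/eqP/hom_coclass_eq0.
by exists y => x; rewrite hom_valB zE; zmod.
Qed.

(** * The long exact sequence of a complex equivalent to a cocone *)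

Section LongExactSequence.
Variables (A : comPzRingType) (N : lmodType A) (a : A) (E E' : cochain A).
Variables (alpha : family (shift (of_cochain E)) (cocone a (of_cochain E')))
  (beta : family (cocone a (of_cochain E')) (shift (of_cochain E))).
Hypotheses (alphac : is_chain alpha) (betac : is_chain beta).
Hypothesis beta_alpha : homotopic (fun i x => beta i (alpha i x)) (fun i x => x).
Hypothesis alpha_beta : homotopic (fun i x => alpha i (beta i x)) (fun i x => x).

Local Notation H := (cohomology (Hom_cochain N E)).
Local Notation H' := (cohomology (Hom_cochain N E')).

Let alpha1 i : {linear E (i + 1) -> E' (i + 1)} := fst \o alpha i.
Let alpha2 i : {linear E (i + 1) -> E' i} := snd \o alpha i.

Let alphaE i x : alpha i x = (alpha1 i x, alpha2 i x).
Proof. by rewrite /=; case: (alpha i x). Qed.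

Let alpha1_d i x :
  alpha1 (i + 1) (cdiff E (i + 1) (i + 1 + 1) x) = cdiff E' (i + 1) (i + 1 + 1) (alpha1 i x).
Proof. by have /(congr1 fst) := alphac x. Qed.

(** The second component of [alpha] is a null-homotopy of [a] times the first; this is why
    multiplication by [a] kills the image of [f]. *)
Let alpha2_d i x :
  alpha2 (i + 1) (cdiff E (i + 1) (i + 1 + 1) x) =
  a *: alpha1 i x - cdiff E' i (i + 1) (alpha2 i x).
Proof. by have /(congr1 snd) := alphac x. Qed.

Let f_ex i : exists F : {linear H (i + 1) -> H' (i + 1)},
  forall z w, (forall x, hom_val w x = alpha1 i (hom_val z x)) -> F (coclass z) = coclass w.
Proof.
apply: (@hom_cohomology_map_ex _ _ _ _ _ _ (alpha1 i)) => [x dx|z w wE].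
  by rewrite -alpha1_d dx linear0.
move=> /hom_coclass_eq0[y yE]; apply/hom_coclass_eq0.
have [j ij] := int_succ i; subst i.
exists (hom_post (alpha1 j) y) => x.
by rewrite wE -yE alpha1_d; congr (cdiff _ _ _ _).
Qed.

Let beta_pair_r i (x : E' i) :
  cdiff E' i (i + 1) x = 0 -> cdiff E (i + 1) (i + 1 + 1) (beta i (0, x)) = 0.
Proof.
move=> dx; have /= -> := betac (0, x).
by rewrite /cocone_diff /= dx linear0 scaler0 subr0 linear0.
Qed.

Let delta_ex i : exists F : {linear H' i -> H (i + 1)},
  forall z w, (forall x, hom_val w x = beta i (0, hom_val z x)) -> F (coclass z) = coclass w.
Proof.
apply: (@hom_cohomology_map_ex _ _ _ _ _ _ (beta i \o pair_r)) => [x dx|z w wE].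
  exact: beta_pair_r.
have [j ij] := int_succ i; subst i.
move=> /hom_coclass_eq0[y yE]; apply/hom_coclass_eq0.
(* The sign comes from the cocone differential, which is [- d] on the second factor. *)
exists (- hom_post (beta j \o pair_r : {linear _ -> _}) y) => x.
have -> : hom_val w x = - d (shift (of_cochain E)) j (beta j (0, y x)).
  rewrite wE -yE betac -linearN /= /cocone_diff /= linear0 scaler0 sub0r.
  by congr (beta _ _); congr pair; rewrite /= ?oppr0 ?opprK.
by rewrite /= linearN.
Qed.

(** The homotopy from [alpha beta] to the identity, read in components on a cocycle [(x, y)] of the
    cocone, where its [h d] term vanishes. *)
Let alpha_beta_cocycle :
  exists (k1 : forall i : int, {linear cocone a (of_cochain E') (i + 1) -> E' (i + 1)})
         (k2 : forall i : int, {linear cocone a (of_cochain E') (i + 1) -> E' i}),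
  forall (i : int) x y, cdiff E' (i + 1 + 1) (i + 1 + 1 + 1) x = 0 ->
    a *: x = cdiff E' (i + 1) (i + 1 + 1) y ->
    alpha1 (i + 1) (beta (i + 1) (x, y)) = x + cdiff E' (i + 1) (i + 1 + 1) (k1 i (x, y)) /\
    alpha2 (i + 1) (beta (i + 1) (x, y)) =
      y + (a *: k1 i (x, y) - cdiff E' i (i + 1) (k2 i (x, y))).
Proof.
have [k kP] := alpha_beta.
exists (fun i => fst \o k i : {linear _ -> _}), (fun i => snd \o k i : {linear _ -> _}).
move=> i x y dx axy.
have d0 : d (cocone a (of_cochain E')) (i + 1) (x, y) = 0.
  by rewrite /= /cocone_diff /= dx axy subrr.
have := kP i (x, y); rewrite d0 linear0 addr0 => e.
by rewrite /= e.
Qed.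

(** The map [f] is induced by the first component of [alpha], and [delta] by [beta] on the second
    factor. Each chase is the one for the cocone itself, with the homotopies supplying the
    correcting boundaries. *)
Lemma long_exact_sequence :
  exists (f : forall i : int, {linear H i -> H' i})
         (delta : forall i : int, {linear H' i -> H (i + 1)}),
    forall i : int,
      [/\ exact_at (f i) (fun x : H' i => a *: x),
          exact_at (fun x : H' i => a *: x) (delta i) &
          exact_at (delta i) (f (i + 1))].
Proof.
pose f' i := projT1 (cid (f_ex i)).
have f'P i z w : (forall x, hom_val w x = alpha1 i (hom_val z x)) -> f' i (coclass z) = coclass w.
  exact: (projT2 (cid (f_ex i))).
have [f fE] := @unshift_family (fun i => {linear H i -> H' i}) f'.
pose delta i := projT1 (cid (delta_ex i)).
have deltaP i z w :
    (forall x, hom_val w x = beta i (0, hom_val z x)) -> delta i (coclass z) = coclass w.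
  exact: (projT2 (cid (delta_ex i))).
exists f, delta => i.
(* Two predecessors are taken: [f] is described only in degrees [i + 1], and the homotopies need one
   degree more. *)
have [j ij] := int_succ i; subst i; have [i ij] := int_succ j; subst j.
rewrite !fE.
have [h hP] := beta_alpha; have [k1 [k2 kP]] := alpha_beta_cocycle.
split; apply/seteqP; split=> v.
- move=> [u _ <-]; rewrite -[u]coclassK; set z := repr u.
  have [|w wE] := @hom_cocycle_ex _ N E' _ (hom_post (alpha1 (i + 1)) (hom_val z)).
    by move=> x; rewrite -alpha1_d hom_cocycleP linear0.
  rewrite (f'P _ _ w) => [/=|x]; last by rewrite wE.
  rewrite -linearZ; apply/hom_coclass_eq0.
  exists (hom_post (alpha2 (i + 1)) (hom_val z)) => x.
  have /eqP := alpha2_d (hom_val z x); rewrite hom_cocycleP linear0 eq_sym subr_eq0.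
  by move=> /eqP e; rewrite -[LHS]e -[alpha1 _ _]/(hom_post _ _ x) -wE.
- rewrite -[v]coclassK; set z := repr v.
  rewrite /preimage /= -linearZ => /hom_coclass_eq0[y yE].
  (* A primitive [y] of [a z] completes [z] to a cocycle [(z, y)] of the cocone; [beta] sends it to
     a preimage of the class of [z], up to the boundary given by [k1]. *)
  have dw x : d (cocone a (of_cochain E')) (i + 1) (hom_val z x, y x) = 0.
    by rewrite /= /cocone_diff /= hom_cocycleP yE subrr.
  have wlin := linear_pair (linearP (hom_val z)) (linearP y).
  have [|g gE] := @hom_cocycle_ex _ N E _ (hom_post (beta (i + 1)) (mklin wlin)).
    by move=> x; have /= -> := betac (hom_val z x, y x); rewrite [cocone_diff _ _]dw linear0.
  exists (coclass g) => //.
  have [|w wE] := @hom_cocycle_ex _ N E' _ (hom_post (alpha1 (i + 1)) (hom_val g)).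
    by move=> x; rewrite -alpha1_d hom_cocycleP linear0.
  rewrite (f'P _ _ w) => [|x]; last by rewrite wE.
  apply: (hom_coclass_eq (y := hom_post (k1 i) (mklin wlin))) => x.
  by rewrite wE /= gE; have [<- _] := kP i (hom_val z x) (y x) (hom_cocycleP _ _) (esym (yE x)).
- move=> [u _ <-]; rewrite -[u]coclassK /preimage /= -linearZ; set z := repr u.
  have [|w wE] := @hom_cocycle_ex _ N E _
      (hom_post (beta (i + 1 + 1) \o pair_r : {linear _ -> _}) (hom_val (a *: z))).
    by move=> x; have := beta_pair_r (hom_cocycleP (a *: z) x).
  rewrite (deltaP _ _ w) => [/=|x]; last by rewrite wE.
  apply/hom_coclass_eq0.
  (* For a cocycle [z] the cocone differential of [(z, 0)] is [(0, a z)]. *)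
  exists (hom_post (beta (i + 1) \o pair_l : {linear _ -> _}) (hom_val z)) => x.
  rewrite wE; have /= -> := betac (hom_val z x, 0).
  by rewrite /cocone_diff /= hom_cocycleP linear0 subr0.
- rewrite -[v]coclassK; set z := repr v; rewrite /preimage /=.
  have [|w wE] := @hom_cocycle_ex _ N E _
      (hom_post (beta (i + 1 + 1) \o pair_r : {linear _ -> _}) (hom_val z)).
    by move=> x; have := beta_pair_r (hom_cocycleP z x).
  rewrite (deltaP _ _ w) => [|x]; last by rewrite wE.
  move=> /hom_coclass_eq0[e eE].
  have abz x := kP (i + 1) 0 (hom_val z x) (linear0 _)
    (etrans (scaler0 _ _) (esym (hom_cocycleP z x))).
  have beta_e x : beta (i + 1 + 1) (0, hom_val z x) = cdiff E _ _ (e x).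
    by rewrite eE wE.
  (* With [beta (0, z) = d e], the homotopy shows that [(0, z)] is the cocone differential of
     [alpha e - k (0, z)]. The first component of this pair is then a cocycle whose multiple by [a]
     is [z] up to the boundary of the second. *)
  pose u0 : Hom N (E' (i + 1 + 1)) := hom_post (alpha1 (i + 1)) e
    - hom_post (k1 (i + 1) \o pair_r : {linear _ -> _}) (hom_val z).
  have u0E x : u0 x = alpha1 (i + 1) (e x) - k1 (i + 1) (0, hom_val z x) by [].
  have [|u uE] := @hom_cocycle_ex _ N E' _ u0.
    move=> x; have [] := abz x; rewrite beta_e alpha1_d add0r => k1E _.
    by rewrite u0E linearB k1E subrr.
  exists (coclass u) => //; rewrite -linearZ.
  apply: (hom_coclass_eq (y := hom_post (alpha2 (i + 1)) e
    - hom_post (k2 (i + 1) \o pair_r : {linear _ -> _}) (hom_val z))) => x.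
  have [_] := abz x; rewrite beta_e alpha2_d => /esym/eqP; rewrite -subr_eq => /eqP k2E.
  have -> : hom_val (a *: u) x = a *: u0 x by rewrite -uE.
  rewrite u0E scalerBr -k2E.
  have -> : (hom_post (alpha2 (i + 1)) e - hom_post (k2 (i + 1) \o pair_r) (hom_val z)) x
      = alpha2 (i + 1) (e x) - k2 (i + 1) (0, hom_val z x) by [].
  by rewrite linearB; zmod.
- move=> [u _ <-]; rewrite -[u]coclassK /preimage /=; set z := repr u.
  have [|w wE] := @hom_cocycle_ex _ N E _
      (hom_post (beta (i + 1 + 1) \o pair_r : {linear _ -> _}) (hom_val z)).
    by move=> x; have := beta_pair_r (hom_cocycleP z x).
  rewrite (deltaP _ _ w) => [|x]; last by rewrite wE.
  have [|t tE] := @hom_cocycle_ex _ N E' _ (hom_post (alpha1 (i + 1 + 1)) (hom_val w)).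
    by move=> x; rewrite -alpha1_d hom_cocycleP linear0.
  rewrite (f'P _ _ t) => [/=|x]; last by rewrite tE.
  apply/hom_coclass_eq0.
  (* The first component of [alpha beta (0, z)] is homologous to that of [(0, z)], which is zero. *)
  exists (hom_post (k1 (i + 1) \o pair_r : {linear _ -> _}) (hom_val z)) => x.
  have [] := kP (i + 1) 0 (hom_val z x) (linear0 _)
    (etrans (scaler0 _ _) (esym (hom_cocycleP z x))).
  by rewrite add0r tE /= wE.
- rewrite -[v]coclassK; set z := repr v; rewrite /preimage /=.
  have [|t tE] := @hom_cocycle_ex _ N E' _ (hom_post (alpha1 (i + 1 + 1)) (hom_val z)).
    by move=> x; rewrite -alpha1_d hom_cocycleP linear0.
  rewrite (f'P _ _ t) => [|x]; last by rewrite tE.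
  move=> /hom_coclass_eq0[y yE].
  have yE' x : cdiff E' (i + 1 + 1) (i + 1 + 1 + 1) (y x) = alpha1 (i + 1 + 1) (hom_val z x).
    by rewrite yE tE.
  (* Subtracting the cocone differential of [(y, 0)] from [alpha z] leaves [(0, u0)]. Hence
     [beta (0, u0)] is homologous to [beta alpha z], and so to [z]. *)
  pose u0 : Hom N (E' (i + 1 + 1)) :=
    hom_post (alpha2 (i + 1 + 1)) (hom_val z) - a *: y.
  have u0E x : u0 x = alpha2 (i + 1 + 1) (hom_val z x) - a *: y x by [].
  have [|u uE] := @hom_cocycle_ex _ N E' _ u0.
    move=> x; have := alpha2_d (hom_val z x); rewrite hom_cocycleP linear0 => /esym/eqP.
    by rewrite subr_eq0 => /eqP e; rewrite u0E linearB linearZ /= yE' e subrr.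
  exists (coclass u) => //.
  have [|w wE] := @hom_cocycle_ex _ N E _
      (hom_post (beta (i + 1 + 1) \o pair_r : {linear _ -> _}) (hom_val u)).
    by move=> x; have := beta_pair_r (hom_cocycleP u x).
  rewrite (deltaP _ _ w) => [|x]; last by rewrite wE.
  apply: (hom_coclass_eq (y := hom_post (h (i + 1)) (hom_val z)
    - hom_post (beta (i + 1) \o pair_l : {linear _ -> _}) y)) => x.
  have /= := hP (i + 1) (hom_val z x); rewrite hom_cocycleP linear0 addr0 => hE.
  have /= := betac (y x, 0 : E' (i + 1)); rewrite /cocone_diff /= yE' linear0 subr0 => bE.
  rewrite linearB bE addrA -hE alphaE -linearB wE.
  rewrite -[LHS]/(beta (i + 1 + 1) (0, hom_val u x)) uE u0E.
  by congr (beta _ _); congr pair; rewrite /= subrr.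
Qed.

End LongExactSequence.

(** * Koszul complexes *)

Section KoszulSign.
Variables (A : comPzRingType) (m : nat).
Implicit Types (S : {set 'I_m}) (j k : 'I_m).
Local Notation sign := (@koszul_sign A m).

Lemma koszul_sign_sq S j : sign S j * sign S j = 1.
Proof. by rewrite -expr2 sqrr_sign. Qed.

Lemma koszul_sign_rem S j k : j \in S ->
  sign (S :\ j)%SET k = (-1) ^+ (j < k)%N * sign S k.
Proof.
move=> jS; rewrite /koszul_sign.
have -> : [set l in (S :\ j)%SET | (l < k)%N]%SET = ([set l in S | (l < k)%N] :\ j)%SET.
  by apply/setP => l; rewrite !inE andbA.
rewrite [in RHS](cardsD1 j) inE jS /= exprD mulrA.
by case: (j < k)%N; rewrite ?mulr1 ?mul1r // mulrNN !mulr1 mul1r.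
Qed.

(** Wedging with [e_j] and contracting along [e_k] anticommute: exactly one of [j < k] and [k < j]
    holds, so exactly one of the two signs flips. *)
Lemma koszul_sign_wedge S j k : j \notin S -> k \in S ->
  sign S k * sign (S :\ k)%SET j = - (sign S j * sign (j |: S)%SET k).
Proof.
move=> jS kS; rewrite koszul_sign_rem //.
have {1}-> : S = ((j |: S) :\ j)%SET by rewrite finset.setU1K.
rewrite koszul_sign_rem ?finset.setU11 //.
have : j != k by apply: contraNneq jS => ->.
rewrite -val_eqE neq_ltn => /orP[] jk; rewrite jk ltnNge ltnW //=;
by rewrite ?(mul1r, mulN1r, mulrN, mulNr) mulrC.
Qed.

End KoszulSign.

Section KoszulValues.
Variables (A : comPzRingType) (m : nat) (u : 'I_m -> A) (M : lmodType A).
Implicit Types S T : {set 'I_m}.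

(** The basis vector [e_S] if [S] has [p] elements, and zero otherwise. Allowing every [S] turns
    cochains into functions on all subsets, with no cardinality proofs to carry. *)
Definition koszul_delta (p : int) (S : {set 'I_m}) : koszul_module A m p :=
  [ffun T => (val T == S)%:R].

Definition koszul_ev (p : int) (f : Hom (koszul_module A m p) M) S : M :=
  f (koszul_delta p S).

Lemma koszul_delta_decomp p (c : koszul_module A m p) :
  c = \sum_T c T *: koszul_delta p (val T).
Proof.
apply/ffunP => T; rewrite sum_ffunE (bigD1 T) //= !ffunE eqxx big1 => [|S ST].
  by rewrite addr0 -[RHS]/(_ * _) mulr1.
by rewrite !ffunE val_eqE eq_sym (negPf ST) scaler0.
Qed.

Lemma koszul_ev_card p (f : Hom (koszul_module A m p) M) S :
  #|S|%:Z != p -> koszul_ev f S = 0.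
Proof.
move=> Sp; rewrite /koszul_ev (_ : koszul_delta p S = 0) ?linear0 //.
apply/ffunP => T; rewrite !ffunE; case: eqP => // TS.
by move: Sp; rewrite -TS (valP T).
Qed.

Lemma koszul_ev_ext p (f g : Hom (koszul_module A m p) M) :
  (forall S, #|S|%:Z = p -> koszul_ev f S = koszul_ev g S) -> f = g.
Proof.
move=> fg; apply: hom_ext => c; rewrite (koszul_delta_decomp c) !linear_sum.
by apply: eq_bigr => T _; rewrite !linearZ; congr (_ *: _); apply: fg; exact/eqP/(valP T).
Qed.

Fact koszul_hom_is_linear p (phi : {set 'I_m} -> M) :
  linear (fun c : koszul_module A m p => \sum_T c T *: phi (val T)).
Proof.
move=> a x y; rewrite scaler_sumr -big_split; apply: eq_bigr => T _ /=.
by rewrite !ffunE scalerA -scalerDl.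
Qed.

Definition koszul_hom p phi : Hom (koszul_module A m p) M :=
  mklin (@koszul_hom_is_linear p phi).

Lemma koszul_hom_ev p phi S :
  koszul_ev (koszul_hom p phi) S = if #|S|%:Z == p then phi S else 0.
Proof.
case: ifP => [Sp|/negbT /koszul_ev_card->//].
rewrite /koszul_ev /= (bigD1 (exist (fun S : {set 'I_m} => #|S|%:Z == p) S Sp)) //=.
rewrite ffunE eqxx scale1r big1 ?addr0 // => T TS.
rewrite ffunE (_ : val T == S = false) ?scale0r //.
by apply: contraNF TS => /eqP TS; apply/eqP/val_inj.
Qed.

Lemma koszul_diff_delta p S :
  @koszul_diff _ _ u (p + 1) p (koszul_delta (p + 1) S) =
  \sum_(j in S) (koszul_sign A S j * u j) *: koszul_delta p (S :\ j)%SET.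
Proof.
apply/ffunP => T; rewrite ffunE sum_ffunE.
have -> : \sum_(j in S) ((koszul_sign A S j * u j) *: koszul_delta p (S :\ j)%SET) T
    = koszul_coef u S (val T).
  rewrite /koszul_coef big_mkcondr; apply: eq_bigr => j _; rewrite !ffunE.
  by case: eqP => _; rewrite ?scaler0 //; exact: mulr1.
have [Sp|Sp] := eqVneq (#|S|%:Z) (p + 1).
  pose S' : koszul_basis m (p + 1) :=
    exist (fun S : {set 'I_m} => #|S|%:Z == p + 1) S (introT eqP Sp).
  rewrite (bigD1 S') //= ffunE eqxx mulr1 big1 ?addr0 // => T' TS.
  rewrite ffunE (_ : val T' == S = false) ?mulr0 //.
  by apply: contraNF TS => /eqP TS; apply/eqP/val_inj.
rewrite big1 => [|T' _]; last first.
  rewrite ffunE (_ : val T' == S = false) ?mulr0 //.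
  by apply: contraNF Sp => /eqP <-; exact: (valP T').
rewrite /koszul_coef big1 // => j /andP[jS /eqP TS].
case/eqP: Sp; have /eqP <- := valP T.
by rewrite TS (cardsD1 j S) jS addnC PoszD.
Qed.

Lemma koszul_cochain_ev p (f : koszul_cochain u M p) S :
  koszul_ev (cdiff (koszul_cochain u M) p (p + 1) f : Hom _ _) S =
  \sum_(j in S) (koszul_sign A S j * u j) *: koszul_ev (f : Hom _ _) (S :\ j)%SET.
Proof.
rewrite /koszul_ev /= koszul_diff_delta linear_sum.
by apply: eq_bigr => j _; rewrite linearZ.
Qed.

End KoszulValues.

Section KoszulHomotopy.
Variables (A : comPzRingType) (m : nat) (u : 'I_m -> A) (M : lmodType A).

Local Notation K := (of_cochain (koszul_cochain u M)).

(** On [e_S] with [j] in [S], only the term removing [j] survives. Otherwise adding and then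
    removing [j] yields [u j], and the other terms cancel in pairs by [koszul_sign_wedge]. *)
Lemma koszul_null_homotopic j :
  homotopic (fun i (x : K i) => u j *: x) (fun i _ => 0).
Proof.
(* Precomposition with the wedge product by [e_j]. *)
pose phi p (f : Hom (koszul_module A m p) M) (S : {set 'I_m}) : M :=
  if j \in S then 0 else koszul_sign A S j *: koszul_ev f (j |: S)%SET.
have hlin i : linear (fun f : K (i + 1) => koszul_hom i (phi _ f) : K i).
  move=> b f g; apply: koszul_ev_ext => S Si.
  have -> : koszul_ev (b *: koszul_hom i (phi _ f) + koszul_hom i (phi _ g) : Hom _ _) S =
      b *: koszul_ev (koszul_hom i (phi _ f)) S + koszul_ev (koszul_hom i (phi _ g)) S by [].
  rewrite !koszul_hom_ev Si eqxx /phi; case: ifP => _; first by rewrite scaler0 addr0.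
  rewrite -[koszul_ev (b *: f + g : Hom _ _) _]/
    (b *: koszul_ev (f : Hom _ _) _ + koszul_ev (g : Hom _ _) _).
  by rewrite scalerDr !scalerA mulrC.
have phi_card i (f : K (i + 1)) S : koszul_ev (koszul_hom i (phi _ f)) S = phi _ f S.
  rewrite koszul_hom_ev; case: eqP => // Si; rewrite /phi; case: ifP => // jS.
  rewrite koszul_ev_card ?scaler0 // cardsU1 jS /= addnC PoszD.
  by apply/eqP => /addIr.
pose h i : {linear K (i + 1) -> K i} := mklin (hlin i).
have hE i (f : K (i + 1)) S : koszul_ev (h i f : Hom _ _) S = phi _ f S by exact: phi_card.
exists h => i f; rewrite add0r.
apply: koszul_ev_ext => S Si.
set dhf := d K i _; set hdf := (X in dhf + X).
have -> : koszul_ev (dhf + hdf : Hom _ _) S =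
    koszul_ev (dhf : Hom _ _) S + koszul_ev (hdf : Hom _ _) S by [].
rewrite -[LHS]/(u j *: koszul_ev (f : Hom _ _) S).
rewrite /dhf /hdf koszul_cochain_ev hE.
under eq_bigr => k kS do rewrite hE /phi.
rewrite /phi; case: ifP => jS.
  rewrite addr0 (bigD1 j) //= !inE eqxx /= big1 => [|k /andP[kS kj]]; last first.
    by rewrite !inE eq_sym kj jS /= scaler0.
  rewrite addr0 finset.setD1K // scalerA koszul_sign_rem // ltnn expr0 mul1r.
  by rewrite mulrAC koszul_sign_sq mul1r.
rewrite koszul_cochain_ev big_setU1 ?jS //= finset.setU1K ?jS // scalerDr scalerA mulrA.
have -> : koszul_sign A (j |: S)%SET j = koszul_sign A S j.
  by rewrite -{2}(finset.setU1K (negbT jS)) koszul_sign_rem ?finset.setU11 // ltnn mul1r.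
rewrite koszul_sign_sq mul1r addrCA scaler_sumr -big_split big1 ?addr0 //= => k kS.
have kj : k != j by apply: contraTneq kS => ->; rewrite jS.
rewrite !inE (eq_sym j) (negPf kj) jS /= !scalerA mulrAC koszul_sign_wedge ?jS //.
have -> : ((j |: S) :\ k)%SET = (j |: S :\ k)%SET.
  rewrite finset.setDUl; congr (_ :|: _)%SET; apply/setP => l; rewrite !inE.
  by case: eqP => // ->; rewrite (negPf kj).
by rewrite -scalerDl mulNr mulrA addNr scale0r.
Qed.

End KoszulHomotopy.

(** * Subsets with and without the last index *)

Section KoszulSplitting.
Variables (A : comPzRingType) (m : nat).
Implicit Types S T : {set 'I_m}.

Local Notation w := (widen_ord (leqnSn m)).

Definition widen_set S : {set 'I_m.+1} := (w @: S)%SET.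

Lemma widen_inj : injective w.
Proof. by move=> i j /(congr1 val) /= ij; apply: val_inj. Qed.

Lemma ord_max_widen S : ord_max \notin widen_set S.
Proof. by apply/imsetP => -[j _ /(congr1 val) /= mj]; move: (ltn_ord j); rewrite -mj ltnn. Qed.

Lemma mem_widen_set j S : (w j \in widen_set S) = (j \in S).
Proof. exact/mem_imset/widen_inj. Qed.

Lemma widen_set_preim (T : {set 'I_m.+1}) : widen_set (w @^-1: T)%SET = (T :\ ord_max)%SET.
Proof.
apply/setP => k; rewrite !inE; apply/imsetP/andP => [[j]|[km kT]].
  rewrite inE => jT -> ; split=> //.
  by rewrite -val_eqE /= ltn_eqF.
have km' : (k < m)%N by have := ltn_ord k; rewrite ltnS leq_eqVlt (negPf (km : val k != m)).
by exists (Ordinal km'); rewrite ?inE; [rewrite (_ : w _ = k) //|]; apply: val_inj.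
Qed.

Lemma preim_widen_set S : (w @^-1: widen_set S)%SET = S.
Proof. by apply/setP => j; rewrite inE mem_widen_set. Qed.

Lemma card_widen_set S : #|widen_set S| = #|S|.
Proof. exact/card_imset/widen_inj. Qed.

Lemma big_widen_set (V : zmodType) S (F : 'I_m.+1 -> V) :
  \sum_(k in widen_set S) F k = \sum_(j in S) F (w j).
Proof. by apply: big_imset => j k _ _; exact: widen_inj. Qed.

Lemma widen_set_rem S j : (widen_set S :\ w j)%SET = widen_set (S :\ j)%SET.
Proof.
apply/setP => k; rewrite !inE; apply/andP/imsetP => [[kj /imsetP[l lS kl]]|[l]].
  by exists l => //; rewrite !inE lS andbT; apply: contraNneq kj => <-; rewrite kl.
by rewrite !inE => /andP[lj lS] ->; rewrite (inj_eq widen_inj) lj mem_widen_set.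
Qed.

Lemma koszul_sign_widen S j : koszul_sign A (widen_set S) (w j) = koszul_sign A S j.
Proof.
rewrite /koszul_sign -(card_widen_set [set k in S | (k < j)%N]%SET).
congr (_ ^+ #|pred_of_set _|); apply/setP => k; rewrite inE.
apply/andP/imsetP => [[/imsetP[l lS ->] lj]|[l]]; first by exists l => //; rewrite inE lS.
by rewrite inE => /andP[lS lj] ->; rewrite mem_widen_set.
Qed.

Lemma koszul_sign_widenU S j :
  koszul_sign A (ord_max |: widen_set S)%SET (w j) = koszul_sign A S j.
Proof.
have := @koszul_sign_rem A _ _ _ (w j) (finset.setU11 ord_max (widen_set S)).
rewrite finset.setU1K ?ord_max_widen // koszul_sign_widen => ->.
by rewrite /= ltnNge ltnW //= mul1r.
Qed.

Lemma koszul_sign_max S : koszul_sign A (ord_max |: widen_set S)%SET ord_max = (-1) ^+ #|S|.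
Proof.
rewrite /koszul_sign -card_widen_set; congr (_ ^+ #|pred_of_set _|).
apply/setP => k; rewrite !inE; case: eqP => [->|_] /=.
  by rewrite ltnn (negPf (ord_max_widen S)).
case kS: (k \in widen_set S) => //=.
by have /imsetP[l _ ->] := kS; rewrite /= ltn_ord.
Qed.

End KoszulSplitting.

(** * Operations on quasi-isomorphisms and homotopy equivalence of resolutions *)

Section QisClosure.
Variable A : comPzRingType.
Implicit Types C D E : complex A.

Lemma bijective_qis C D (s : family C D) :
  is_chain s -> (forall i, injective (s i)) -> (forall i y, exists x, s i x = y) -> qis s.
Proof.
move=> sc s_inj s_surj; split=> [i x y dx sxE|i y dy].
  have [z zE] := s_surj i y; exists z; apply: s_inj.
  by rewrite sxE -sc zE.
have [x xE] := s_surj _ y; exists x, 0; rewrite linear0 addr0; split=> //.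
by apply: s_inj; rewrite -sc xE dy linear0.
Qed.

Definition comp_family C D E (t : family D E) (s : family C D) : family C E :=
  fun i => t i \o s i.

Lemma comp_chain C D E (t : family D E) (s : family C D) :
  is_chain t -> is_chain s -> is_chain (comp_family t s).
Proof. by move=> tc sc i x; rewrite /= tc sc. Qed.

Lemma comp_qis C D E (t : family D E) (s : family C D) :
  is_chain t -> is_chain s -> qis t -> qis s -> qis (comp_family t s).
Proof.
move=> tc sc [t_inj t_surj] [s_inj s_surj]; split=> [i x y dx tsx|i y dy].
  have [|z zE] := t_inj i (s _ x) y _ tsx; first by rewrite sc dx linear0.
  exact: s_inj dx zE.
have [x [w [dx ->]]] := t_surj _ _ dy; have [x' [w' [dx' ->]]] := s_surj _ _ dx.
exists x', (t i w' + w); split=> //.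
by rewrite !linearD tc addrA.
Qed.

Lemma shift_qis C D (s : family C D) : qis s ->
  qis ((fun i => s (i + 1)) : family (shift C) (shift D)).
Proof. by move=> [s_inj s_surj]; split=> i; [exact: s_inj | exact: s_surj]. Qed.

Lemma shift_chain C D (s : family C D) : is_chain s ->
  is_chain ((fun i => s (i + 1)) : family (shift C) (shift D)).
Proof. by move=> sc i x; exact: sc. Qed.

Lemma shift_bounded_below C : bounded_below C -> bounded_below (shift C).
Proof. by move=> /bounded_below_pred[n nP]; exists n => i /nP[]. Qed.

(** Extend [t] along [s] to get [f], and [s] along [t] to get [g]. Then [g f s] is homotopic to
    [g t] and so to [s], and uniqueness of extensions compares [g f] with the identity; the other
    composite is symmetric. *)
Lemma qis_homotopy_equivalence C D E (s : family C D) (t : family C E) :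
  is_chain s -> is_chain t -> qis s -> qis t ->
  injective_complex D -> bounded_below D -> injective_complex E -> bounded_below E ->
  exists (f : family D E) (g : family E D), [/\ is_chain f, is_chain g,
    homotopic (fun i x => g i (f i x)) (fun i x => x) &
    homotopic (fun i x => f i (g i x)) (fun i x => x)].
Proof.
move=> sc tc sq tq Dinj Dbd Einj Ebd.
have [f [fc fst]] := qis_lift sc sq Einj Ebd tc.
have [g [gc gts]] := qis_lift tc tq Dinj Dbd sc.
pose idf C : family C C := fun i => idfun.
have idc C' : is_chain (idf C') by [].
exists f, g; split=> //.
- apply: (qis_homotopic sc sq Dinj Dbd (g := comp_family g f) (g' := idf D)) => //.
    exact: comp_chain.
  exact: homotopic_trans (homotopic_post gc fst) gts.
- apply: (qis_homotopic tc tq Einj Ebd (g := comp_family f g) (g' := idf E)) => //.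
    exact: comp_chain.
  exact: homotopic_trans (homotopic_post fc gts) fst.
Qed.

End QisClosure.

(** * The Koszul complex as a cocone *)

Section KoszulCocone.
Variables (A : comPzRingType) (m : nat) (u : 'I_m.+1 -> A) (M : lmodType A).

Local Notation w := (widen_ord (leqnSn m)).
Local Notation K := (of_cochain (koszul_cochain u M)).
Local Notation K' := (of_cochain (koszul_cochain (drop_last u) M)).
Local Notation eps i := ((-1) ^+ absz i : A).

Let epsS (i : int) : eps (i + 1) = - eps i.
Proof.
case: i => n; first by rewrite -PoszD addn1 /= exprS mulN1r.
(* For negative [i] the absolute value decreases by one, and the parity still flips. *)
by rewrite NegzE -[in LHS]addn1 PoszD opprD subrK !abszN !absz_nat exprS mulN1r opprK.
Qed.

Let split1 i (f : K (i + 1)) : K' (i + 1) :=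
  koszul_hom (i + 1) (fun S => koszul_ev (f : Hom _ _) (widen_set S)).
(* The sign accounts for the sign of [d] on the second factor of the cocone. *)
Let split2 i (f : K (i + 1)) : K' i :=
  koszul_hom i (fun S => eps i *: koszul_ev (f : Hom _ _) (ord_max |: widen_set S)%SET).

Let card_maxU (S : {set 'I_m}) : #|(ord_max |: widen_set S)%SET|%:Z = #|S|%:Z + 1.
Proof. by rewrite cardsU1 ord_max_widen card_widen_set addnC PoszD. Qed.

Let split1_ev i f S : koszul_ev (@split1 i f : Hom _ _) S = koszul_ev (f : Hom _ _) (widen_set S).
Proof.
rewrite koszul_hom_ev; case: eqP => // /eqP Si.
by rewrite koszul_ev_card // card_widen_set.
Qed.

Let split2_ev i f S : koszul_ev (@split2 i f : Hom _ _) S =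
  eps i *: koszul_ev (f : Hom _ _) (ord_max |: widen_set S)%SET.
Proof.
rewrite koszul_hom_ev; case: eqP => // Si.
by rewrite koszul_ev_card ?scaler0 // card_maxU; apply/eqP => /addIr.
Qed.

Let split1_linear i : linear (@split1 i).
Proof.
move=> b f g; apply: koszul_ev_ext => S _.
rewrite split1_ev -[RHS]/(b *: koszul_ev (split1 f : Hom _ _) S + koszul_ev (split1 g : Hom _ _) S).
by rewrite !split1_ev.
Qed.

Let split2_linear i : linear (@split2 i).
Proof.
move=> b f g; apply: koszul_ev_ext => S _.
rewrite split2_ev -[RHS]/(b *: koszul_ev (split2 f : Hom _ _) S + koszul_ev (split2 g : Hom _ _) S).
rewrite !split2_ev scalerA mulrC -scalerA -scalerDr.
by [].
Qed.

(** The values of a cochain on the sets without the last index form the first component; those on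
    the sets containing it form the second, one degree lower. *)
Definition koszul_split : family (shift K) (cocone (u ord_max) K') :=
  fun i => mklin (linear_pair (@split1_linear i) (@split2_linear i)).

Lemma koszul_split_chain : is_chain koszul_split.
Proof.
move=> i f; congr pair; apply: koszul_ev_ext => S Si.
  rewrite -[RHS]/(koszul_ev
    (split1 (cdiff (koszul_cochain u M) (i + 1) (i + 1 + 1) f) : Hom _ _) S).
  rewrite koszul_cochain_ev split1_ev koszul_cochain_ev.
  rewrite big_widen_set -[(koszul_split i f).1]/(split1 f).
  by apply: eq_bigr => j _; rewrite split1_ev widen_set_rem koszul_sign_widen.
rewrite -[RHS]/(koszul_ev
  (split2 (cdiff (koszul_cochain u M) (i + 1) (i + 1 + 1) f) : Hom _ _) S).
rewrite split2_ev koszul_cochain_ev.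
rewrite -[LHS]/(u ord_max *: koszul_ev (split1 f : Hom _ _) S
  - koszul_ev (cdiff (koszul_cochain (drop_last u) M) i (i + 1) (split2 f) : Hom _ _) S).
rewrite split1_ev koszul_cochain_ev big_setU1 ?ord_max_widen // finset.setU1K ?ord_max_widen //.
(* Here [S] has [i + 1] elements, so [eps] cancels the sign of removing the last index. *)
have epsi : eps (i + 1) = (-1) ^+ #|S| by rewrite -Si.
rewrite koszul_sign_max scalerDr scalerA mulrA epsi -expr2 sqrr_sign mul1r.
congr (_ + _); rewrite -sumrN scaler_sumr.
rewrite [RHS]big_widen_set.
apply: eq_bigr => j jS; rewrite split2_ev koszul_sign_widenU.
have -> : ((ord_max |: widen_set S) :\ w j = ord_max |: widen_set (S :\ j))%SET.
  rewrite -widen_set_rem finset.setDUl; congr (_ :|: _)%SET.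
  apply/setP => k; rewrite !inE; case: eqP => // ->; apply/esym/eqP => /(congr1 val) /= e.
  by move: (ltn_ord j); rewrite e ltnn.
rewrite !scalerA -scaleNr; congr (_ *: _).
by rewrite -epsi epsS mulNr [in RHS]mulrC.
Qed.

(** The splitting is bijective in each degree: a cochain amounts to arbitrary values on the subsets
    of the right size, and each subset is of exactly one of the two kinds. *)
Lemma koszul_split_qis : qis koszul_split.
Proof.
have setE (T : {set 'I_m.+1}) : exists S, T = widen_set S \/ T = (ord_max |: widen_set S)%SET.
  exists (w @^-1: T)%SET; rewrite widen_set_preim; case: (boolP (ord_max \in T)) => mT.
    by right; rewrite finset.setD1K.
  by left; apply/setP => k; rewrite !inE; case: eqP => // ->; rewrite (negPf mT).
have eps_sq i : eps i * eps i = 1 by rewrite -expr2 sqrr_sign.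
apply: bijective_qis koszul_split_chain _ _ => i.
  move=> f g fg; apply: koszul_ev_ext => T _.
  have /= fg1 : split1 f = split1 g by have := congr1 fst fg.
  have /= fg2 : split2 f = split2 g by have := congr1 snd fg.
  have [S [->|->]] := setE T; first by rewrite -!split1_ev fg1.
  have epsK : involutive (fun x : M => eps i *: x) by move=> x; rewrite scalerA eps_sq scale1r.
  by apply: (inv_inj epsK); rewrite -!split2_ev fg2.
move=> [x y].
(* The inverse of the splitting; the sign [eps i] is its own inverse. *)
pose phi (T : {set 'I_m.+1}) := if ord_max \in T
  then eps i *: koszul_ev (y : Hom _ _) (w @^-1: T)%SET
  else koszul_ev (x : Hom _ _) (w @^-1: T)%SET.
exists (koszul_hom (i + 1) phi); congr pair; apply: koszul_ev_ext => S Si.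
  rewrite split1_ev koszul_hom_ev card_widen_set Si eqxx /phi.
  by rewrite (negPf (ord_max_widen S)) preim_widen_set.
rewrite split2_ev koszul_hom_ev card_maxU Si eqxx /phi finset.setU11 scalerA eps_sq scale1r.
congr koszul_ev; apply/setP => k; rewrite !inE mem_widen_set.
by rewrite (_ : w k == ord_max = false) //; apply/negbTE; rewrite -val_eqE /= ltn_eqF.
Qed.

End KoszulCocone.

(** * The modules [V] *)

Lemma Vmod_scale_ideal (A : comPzRingType) (m : nat) (u : 'I_m -> A) (N M : lmodType A)
    (E : injective_resolution (koszul_cochain u M)) b i (v : Vmod u N M E i) :
  gen_ideal u b -> b *: v = 0.
Proof.
move=> [c ->]; rewrite scaler_suml big1 // => j _.
rewrite -scalerA [u j *: v](cohomology_scale0 (koszul_null_homotopic u M j)).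
exact: scaler0.
Qed.

Lemma Vmod_scale_ann (A : comPzRingType) (m : nat) (u : 'I_m -> A) (N M : lmodType A)
    (E : injective_resolution (koszul_cochain u M)) b i (v : Vmod u N M E i) :
  ann M b \/ ann N b -> b *: v = 0.
Proof.
case=> [bM|bN].
  apply: cohomology_scale0.
  pose h p : {linear of_cochain (koszul_cochain u M) (p + 1) ->
    of_cochain (koszul_cochain u M) p} := \0.
  exists h => p f; rewrite linear0 !addr0 /=.
  by apply: hom_ext => x; exact: bM.
(* A scalar acting on a homomorphism out of [N] moves to its argument. *)
rewrite -[v]coclassK -linearZ (_ : b *: _ = 0) ?linear0 //.
apply: val_inj; apply: hom_ext => x.
rewrite -[LHS]/(b *: hom_val (repr v) x) -linearZ bN linear0.
by [].
Qed.

Lemma Vstar_scale0 (A : comPzRingType) (m : nat) (u : 'I_m -> A) (N M : lmodType A)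
    (E : injective_resolution (koszul_cochain u M)) b (v : Vstar u N M E) :
  (forall i (x : Vmod u N M E i), b *: x = 0) -> b *: v = 0.
Proof.
move=> b0; apply: val_inj; apply: functional_extensionality_dep => i.
exact: b0.
Qed.

Theorem theorem1p16 (A : comPzRingType) (hA : noetherian A)
    (m : nat) (u : 'I_m.+1 -> A) (M N : lmodType A) (hM : fin_gen M) (hN : fin_gen N)
    (E : injective_resolution (koszul_cochain u M))
    (E' : injective_resolution (koszul_cochain (drop_last u) M)) :
  [/\ ideal_smul (Vstar u N M E) (gen_ideal u) = [set 0],
      ideal_add (ann M) (ann N) `<=` ann (Vstar u N M E) &
      exists (f : forall i : int, {linear Vmod u N M E i -> Vmod (drop_last u) N M E' i})
             (delta : forall i : int, {linear Vmod (drop_last u) N M E' i -> Vmod u N M E (i + 1)}),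
        forall i : int,
          [/\ exact_at (f i) (fun x : Vmod (drop_last u) N M E' i => u ord_max *: x),
              exact_at (fun x : Vmod (drop_last u) N M E' i => u ord_max *: x) (delta i) &
              exact_at (delta i) (f (i + 1))]].
Proof.
split.
- apply/seteqP; split=> [v [n [b [x [bI ->]]]]|v ->].
    rewrite /= big1 // => k _; apply: Vstar_scale0 => i y.
    exact: Vmod_scale_ideal.
  (* Zero is the empty sum. *)
  exists 0%N, (fun=> 0), (fun=> 0); split; first by case.
  by rewrite big_ord0.
- move=> _ [b [c [bM cN ->]]] v; apply: Vstar_scale0 => i x.
  by rewrite scalerDl !Vmod_scale_ann ?addr0; [|right|left].
(* The shift of [E] and the cocone of [u ord_max] on [E'] both receive a quasi-isomorphism from the
   shifted Koszul complex of [u], the second one through [koszul_split]. *)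
have [] := @qis_homotopy_equivalence _ _ _ _
  ((fun i => augmentation E (i + 1)) : family (shift _) (shift _))
  (comp_family (cocone_map (u ord_max) (augmentation E')) (koszul_split u M)).
- exact/shift_chain/augmentation_chain.
- apply: comp_chain; last exact: koszul_split_chain.
  exact/cocone_map_chain/augmentation_chain.
- exact/shift_qis/augmentation_qis.
- apply: comp_qis; first exact/cocone_map_chain/augmentation_chain.
  + exact: koszul_split_chain.
  + exact/cocone_map_qis/augmentation_qis/augmentation_chain.
  + exact: koszul_split_qis.
- by move=> i; exact: resolution_injective.
- exact/shift_bounded_below/resolution_bounded_below.
- exact/cocone_injective/resolution_injective.
- exact/cocone_bounded_below/resolution_bounded_below.
move=> alpha [beta [alphac betac beta_alpha alpha_beta]].
exact: long_exact_sequence beta_alpha alpha_beta.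
Qed.
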